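(* Let $k$ be algebraically closed of characteristic zero and $q\in k^\times$ not a root of unity. Let $\pi$ be the map from $q$-conjugacy classes of $\widetilde{GL}_n(k((t)))$ to $q$-conjugacy classes of $GL_n(k((t)))$ induced by $(g,\omega)\mapsto g$. The group $k^\times$ acts on the former set by $(g,\omega)\mapsto(g,c\omega)$. Let $\mathcal O$ be a $q$-conjugacy class in $GL_n(k((t)))$ whose associated $D_q$-module $(k((t))^n,v\mapsto g\sigma_q(v))$, for $g\in\mathcal O$, is isomorphic to $\bigoplus_{i=1}^lJ_{d_i}\otimes V_{r_i,s_i}(\lambda_i)$. (i) If $r_i\neq0$ for some $i$, then $\pi^{-1}(\mathcal O)$ consists of exactly one class. (ii) If $r_i=0$ for all $i$, then $k^\times$ acts simply transitively on $\pi^{-1}(\mathcal O)$, so $\pi^{-1}(\mathcal O)$ is a $k^\times$-torsor.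
   Context: $\sigma_q(a(t))=a(qt)$ on $k((t))$, applied entrywise. $q$-conjugation in a group with a $\sigma_q$-action is $x\mapsto yx\sigma_q(y)^{-1}$. Lattices and determinant lines: - Lattices are $k[[t]]$-spans of bases. $L_0=k[[t]]^n$. - For lattices $L,L'$, $\det(L,L')=\wedge^{top}_k(L'/L\cap L')\otimes_k(\wedge^{top}_k(L/L\cap L'))^*$ is a one-dimensional $k$-space, with nonzero vectors $\det(L,L')^\times$. - The canonical isomorphisms $\det(L,L')\otimes\det(L',L'')\to\det(L,L'')$ are written $\wedge$. A linear or $\sigma_q$-semilinear bijection $\phi$ induces $\det(L,L')\to\det(\phi L,\phi L')$. $\widetilde{GL}_n(k((t)))$ is the group of pairs $(g,\omega_g)$ with $g\in GL_n(k((t)))$ and $\omega_g\in\det(L_0,gL_0)^\times$, with product $(g,\omega_g)(h,\omega_h)=(gh,\omega_g\wedge g\omega_h)$. $\sigma_q$ acts by $(g,\omega)\mapsto(\sigma_q g,\sigma_q\omega)$. $D_q$-modules are finite-dimensional $k((t))$-spaces with a bijective $\sigma_q$-semilinear $\Phi$. We use the following modules, each with $\Phi$ given by left multiplication by $T$ on the skew polynomial ring $k((t))_q[T]$ (where $Ta=\sigma_q(a)T$): - $V_{r,s}(\lambda)=k((t))_q[T]/k((t))_q[T](T^s-\lambda t^r)$, with $s\ge1$, $\gcd(r,s)=1$ and $\lambda\in k^\times$; - $J_d=k((t))_q[T]/k((t))_q[T](T-1)^d$. The tensor product is $V\otimes W$ with $\Phi_V\otimes\Phi_W$. Every $D_q$-module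 is isomorphic to such a direct sum, with the multiset of $(d_i,r_i,s_i,\lambda_i\bmod q^{\mathbb Z})$ uniquely determined. *)

(* Defs.v *)
From HB Require Import structures.
From mathcomp Require Import all_boot all_order all_algebra.
From Stdlib Require Import ClassicalEpsilon.
Set Implicit Arguments. Unset Strict Implicit. Unset Printing Implicit Defensive.
Import Order.TTheory GRing.Theory Num.Theory.
Local Open Scope ring_scope.

Section Defs.
Variable k : fieldType.

Definition laur := int -> k.
Definition is_laurent (f : laur) : Prop := exists N : int, forall i : int, i < N -> f i = 0.

Definition lo (f : laur) : int :=
  epsilon (inhabits 0%R) (fun N : int => forall i : int, i < N -> f i = 0).

Definition lzero : laur := fun _ => 0.
Definition lconst (c : k) : laur := fun m => if m == 0 then c else 0.
Definition lmono (c : k) (r : int) : laur := fun m => if m == r then c else 0.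
Definition ladd (f g : laur) : laur := fun m => f m + g m.
Definition lmul (f g : laur) : laur := fun m =>
  if lo f + lo g <= m then
    \sum_(j < (absz (m - lo f - lo g)%R).+1) f (lo f + j%:Z) * g (m - lo f - j%:Z)
  else 0.
(* sigma_q (a(t)) = a(q t) *)
Definition lsig (q : k) (f : laur) : laur := fun m => q ^ m * f m.

Definition vec (I : finType) := I -> laur.
Definition mat (I J : finType) := I -> J -> laur.

Definition is_vec (I : finType) (v : vec I) := forall i, is_laurent (v i).
Definition is_mat (I J : finType) (A : mat I J) := forall i j, is_laurent (A i j).

Definition lsum (J : finType) (F : J -> laur) : laur := fun m => \sum_j F j m.
Definition matvec (I J : finType) (A : mat I J) (v : vec J) : vec I :=
  fun i => lsum (fun j => lmul (A i j) (v j)).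
Definition matmul (I J K : finType) (A : mat I J) (B : mat J K) : mat I K :=
  fun i l => lsum (fun j => lmul (A i j) (B j l)).
Definition mat1 (I : finType) : mat I I := fun i j => if i == j then lconst 1 else lzero.
Definition vsig (q : k) (I : finType) (v : vec I) : vec I := fun i => lsig q (v i).
Definition msig (q : k) (I J : finType) (A : mat I J) : mat I J := fun i j => lsig q (A i j).
Definition vsub (I : finType) (v w : vec I) : vec I := fun i m => v i m - w i m.

Definition is_GL (n : nat) (g : mat 'I_n 'I_n) : Prop :=
  is_mat g /\ exists h : mat 'I_n 'I_n,
    is_mat h /\ matmul g h = @mat1 'I_n /\ matmul h g = @mat1 'I_n.

(* q-conjugacy in GL_n : g' = y g sigma_q(y)^{-1} *)
Definition qconj (q : k) (n : nat) (g g' : mat 'I_n 'I_n) : Prop :=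
  exists y, is_GL y /\ matmul g' (msig q y) = matmul y g.

Definition vset (n : nat) := vec 'I_n -> Prop.
Definition L0 (n : nat) : vset n := fun v => is_vec v /\ forall i (m : int), m < 0 -> v i m = 0.
Definition lat (n : nat) (g : mat 'I_n 'I_n) : vset n := fun w => exists v, L0 v /\ w = matvec g v.
Definition capL (n : nat) (L L' : vset n) : vset n := fun v => L v /\ L' v.

Definition kcomb (n d : nat) (c : 'I_d -> k) (b : 'I_d -> vec 'I_n) : vec 'I_n :=
  fun i m => \sum_j c j * b j i m.

(* b (a family of d vectors) projects to a k-basis of L/M  (M a sublattice of L) *)
Definition basis_mod (n : nat) (L M : vset n) (d : nat) (b : 'I_d -> vec 'I_n) : Prop :=
  [/\ forall j, L (b j),
      forall v, L v -> exists c, M (vsub v (kcomb c b))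
    & forall c, M (kcomb c b) -> forall j, c j = 0].

Definition trans (n : nat) (M : vset n) (e : nat) (g : 'I_e -> vec 'I_n)
  (d : nat) (b : 'I_d -> vec 'I_n) (P : 'M[k]_(d, e)) : Prop :=
  forall j, M (vsub (g j) (kcomb (fun i => P i j) b)).

(* determinant of a transition matrix between bases (square when it matters) *)
Definition sdet (d e : nat) (P : 'M[k]_(d, e)) : k :=
  match d =P e with ReflectT H => \det (castmx (H, erefl e) P) | ReflectF _ => 0 end.

Definition catb (n d m : nat) (b : 'I_d -> vec 'I_n) (u : 'I_m -> vec 'I_n) : 'I_(d + m) -> vec 'I_n :=
  fun i => match split i with inl a => b a | inr c => u c end.

(* ---------- determinant lines ----------
   An element w of det(L,L') = wedge^top(L'/L∩L') (x) (wedge^top(L/L∩L'))^* is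
   recorded by its coordinates: w d' b' d b = the scalar c with
   w = c . (wedge b') (x) (wedge b)^*, for b' a basis of L'/L∩L', b of L/L∩L'. *)
Definition detfun (n : nat) :=
  forall d' : nat, ('I_d' -> vec 'I_n) -> forall d : nat, ('I_d -> vec 'I_n) -> k.

Definition is_detvec (n : nat) (L L' : vset n) (w : detfun n) : Prop :=
  let I := capL L L' in
  (forall d' b' d b, basis_mod L' I b' -> basis_mod L I b -> @w d' b' d b != 0) /\
  (forall d' b' e' g' d b e g (P' : 'M[k]_(d', e')) (P : 'M[k]_(d, e)),
      basis_mod L' I b' -> basis_mod L' I g' -> basis_mod L I b -> basis_mod L I g ->
      trans I g' b' P' -> trans I g b P ->
      @w e' g' e g = @w d' b' d b * sdet P / sdet P').

Definition deq (n : nat) (L L' : vset n) (w w2 : detfun n) : Prop :=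
  forall d' b' d b, basis_mod L' (capL L L') b' -> basis_mod L (capL L L') b ->
    @w d' b' d b = @w2 d' b' d b.

(* coefficient of w in det(L,L'), transported to
   wedge^top(L'/M) (x) wedge^top(L/M)^* for a lattice M inside L∩L'
   (bases of L∩L'/M appended at the end) *)
Definition coefM (n : nat) (L L' : vset n) (w : detfun n) (M : vset n)
  (e' : nat) (g' : 'I_e' -> vec 'I_n) (e : nat) (g : 'I_e -> vec 'I_n) (c : k) : Prop :=
  exists d' b' d b m u (P' : 'M[k]_(d' + m, e')) (P : 'M[k]_(d + m, e)),
    [/\ basis_mod L' (capL L L') b', basis_mod L (capL L L') b,
        @basis_mod n (capL L L') M m u,
        trans M g' (catb b' u) P' /\ trans M g (catb b u) P
      & c = @w d' b' d b * sdet P / sdet P'].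

(* the canonical isomorphism  det(L,L') (x) det(L',L'') -> det(L,L''): w3 = w1 ∧ w2 *)
Definition wedge_rel (n : nat) (L L' L'' : vset n) (w1 w2 w3 : detfun n) : Prop :=
  let M := capL (capL L L') L'' in
  forall e g e' g' e'' g'' c1 c2,
    @basis_mod n L M e g -> @basis_mod n L' M e' g' -> @basis_mod n L'' M e'' g'' ->
    coefM L L' w1 M g' g c1 -> coefM L' L'' w2 M g'' g' c2 ->
    coefM L L'' w3 M g'' g (c1 * c2).

(* w2 = phi(w) in det(phi L, phi L') for a bijection phi of k((t))^n (linear or
   sigma_q-semilinear, in both cases k-linear) *)
Definition transport_rel (n : nat) (phi : vec 'I_n -> vec 'I_n) (L L' : vset n)
  (w w2 : detfun n) : Prop :=
  forall d' b' d b, basis_mod L' (capL L L') b' -> basis_mod L (capL L L') b ->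
    @w2 d' (fun j => phi (b' j)) d (fun j => phi (b j)) = @w d' b' d b.

Definition tgl (n : nat) := (mat 'I_n 'I_n * detfun n)%type.

Definition tvalid (n : nat) (x : tgl n) : Prop := is_GL x.1 /\ is_detvec (@L0 n) (lat x.1) x.2.

Definition teq (n : nat) (x y : tgl n) : Prop := x.1 = y.1 /\ deq (@L0 n) (lat x.1) x.2 y.2.

(* z = x y :  (g,w_g)(h,w_h) = (gh, w_g ∧ g w_h) *)
Definition tmul_rel (n : nat) (x y z : tgl n) : Prop :=
  z.1 = matmul x.1 y.1 /\
  exists w, is_detvec (lat x.1) (lat z.1) w /\
    transport_rel (matvec x.1) (@L0 n) (lat y.1) y.2 w /\
    wedge_rel (@L0 n) (lat x.1) (lat z.1) x.2 w z.2.

Definition tsig_rel (q : k) (n : nat) (x y : tgl n) : Prop :=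
  y.1 = msig q x.1 /\ transport_rel (@vsig q 'I_n) (@L0 n) (lat x.1) x.2 y.2.

(* x' = y x sigma_q(y)^{-1}, i.e. x' sigma_q(y) = y x, for some y in GL~_n *)
Definition tqconj (q : k) (n : nat) (x x' : tgl n) : Prop :=
  exists y sy z, [/\ tvalid y /\ tvalid sy, tvalid z, tsig_rel q y sy,
                     tmul_rel x' sy z & tmul_rel y x z].

Definition tscale (n : nat) (c : k) (x : tgl n) : tgl n :=
  (x.1, fun d' b' d b => c * x.2 d' b' d b).

(* ---------- D_q-modules ----------
   A D_q-module structure on k((t))^I (I a finite index type) with
   Phi(v) = A sigma_q(v). *)
Record dqmod := DqMod { dq_idx : finType; dq_mat : mat dq_idx dq_idx }.

Definition dq_iso (q : k) (V W : dqmod) : Prop :=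
  exists (Y : mat (dq_idx W) (dq_idx V)) (Z : mat (dq_idx V) (dq_idx W)),
    [/\ is_mat Y, is_mat Z, matmul Y Z = @mat1 (dq_idx W), matmul Z Y = @mat1 (dq_idx V)
      & forall v : vec (dq_idx V), is_vec v ->
          matvec Y (matvec (@dq_mat V) (vsig q v)) = matvec (@dq_mat W) (vsig q (matvec Y v))].

Definition module_of (n : nat) (g : mat 'I_n 'I_n) : dqmod := @DqMod 'I_n g.

(* Matrix of Phi (left multiplication by T) on k((t))_q[T]/k((t))_q[T](T-1)^dd
   in the k((t))-basis 1, T, ..., T^(dd-1):  T^dd = - sum_(a<dd) C(dd,a)(-1)^(dd-a) T^a *)
Definition Jent (dd : nat) (a a' : nat) : laur :=
  if (a'.+1 < dd)%N then (if a == a'.+1 then lconst 1 else lzero)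
  else lconst (- ('C(dd, a)%:R * (-1) ^+ (dd - a)%N)).

(* Matrix of Phi on k((t))_q[T]/k((t))_q[T](T^s - lam t^r) in the basis
   1, T, ..., T^(s-1):  T^s = lam t^r *)
Definition Vent (s : nat) (r : int) (lam : k) (b b' : nat) : laur :=
  if (b'.+1 < s)%N then (if b == b'.+1 then lconst 1 else lzero)
  else (if b == 0%N then lmono lam r else lzero).

(* Index type of (+)_i J_{d_i} (x) V_{r_i,s_i}(lam_i): basis T^a (x) T^b in the
   i-th summand *)
Definition decomp_idx (l : nat) (d s : 'I_l -> nat) : finType :=
  {i : 'I_l & ('I_(d i) * 'I_(s i))%type}.

(* (+)_i J_{d_i} (x) V_{r_i,s_i}(lam_i): block diagonal, Kronecker blocks *)
Definition decomp (l : nat) (d s : 'I_l -> nat) (r : 'I_l -> int) (lam : 'I_l -> k) : dqmod :=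
  @DqMod (decomp_idx d s) (fun x y =>
    if tag x == tag y then
      lmul (Jent (d (tag y)) (tagged x).1 (tagged y).1)
           (Vent (s (tag y)) (r (tag y)) (lam (tag y)) (tagged x).2 (tagged y).2)
    else lzero).

End Defs.

(* Main.v *)
Require Import Defs.
From HB Require Import structures.
From mathcomp Require Import all_boot all_order all_algebra.
From Stdlib Require Import ClassicalEpsilon.
From mathcomp Require Import boolp functions ring zify.
Set Implicit Arguments. Unset Strict Implicit. Unset Printing Implicit Defensive.
Import Order.TTheory GRing.Theory Num.Theory.
Local Open Scope ring_scope.

(** Choose once and for all a scalar [vol L M h] for every basis [h] of [L/M],
[M] and [L] lattices, multiplicative along [N < M < L] and changing by
determinants.  This trivialises all determinant lines: an element of [det(L,L')]
becomes a scalar, the canonical maps [/\] become products, and an automorphism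
[phi] of [k((t))^n] acts on [det(L,L')] as a factor [c_phi(L,L')] which is
additive in [L,L'] and functorial in [phi].  With [Phi_i = g_i sigma_q], two
elements [(g1,w1)], [(g2,w2)] are then q-conjugate by a lift of [Y] (where
[Y g1 = g2 sigma_q(Y)]) iff [w2 = kappa(Y) w1] with
[kappa(Y) = c_Y(L0, Phi_1 L0) / c_(Phi_2)(L0, Y L0)], whatever the lift, and
[kappa] is a cocycle.  Hence everything depends on the values of the character
[kappa] on the automorphisms of the module.  If some [r_i <> 0], the scalar [a] on
the [i]-th block gives [a^(- r_i d_i)], and these exhaust [k^*].  If all [r_i = 0],
the [lam_i] can be normalised modulo [q^Z] so that all automorphisms are
constant matrices; they preserve [L0], and [kappa = 1]. *)

(** * Bases of quotients and relative determinants *)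

(** Determinant lines are stored as functions on pairs of bases, so working with them directly would
    drag bases, transition matrices and sizes through every identity. A compatible system [vol]
    exists because all lattices are commensurable with the single chain [t^N L0], whose successive
    quotients have standard bases: the determinant of a basis is measured at a level [N] so deep
    that it stops changing. The subtle point is that [kappa] compares two different matrices: the
    passage from [g] to the model is itself a q-conjugation whose [kappa] is unknown, and only the
    cocycle rule makes it drop out. In case (ii), coprimality with [r_i = 0] forces [s_i = 1], so
    the model is a constant matrix; the coefficient of [t^m] in an automorphism then intertwines
    unipotent blocks up to the ratio [q^m lam_i / lam_j]. Normalisation, which needs [q] not to be a
    root of unity, keeps this ratio away from 1 unless [m = 0], and a Sylvester argument kills the
    coefficient. In case (i), algebraic closure provides the roots that solve
    [a^(- r_i d_i) = c]. *)

Section LinAlg.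
Variables (k : fieldType) (U : lmodType k).
Implicit Types (L M V : U -> Prop).

Definition subsp (A : U -> Prop) := A 0 /\ forall a v w, A v -> A w -> A (a *: v + w).
Definition subs (A B : U -> Prop) := forall v, A v -> B v.

Lemma subsp0 (A : U -> Prop) : subsp A -> A 0. Proof. by case. Qed.
Lemma subspD (A : U -> Prop) : subsp A -> forall v w, A v -> A w -> A (v + w).
Proof. by move=> [_ h] v w /(h 1 v w) + /[dup] hw => /[apply]; rewrite scale1r. Qed.
Lemma subspZ (A : U -> Prop) : subsp A -> forall a v, A v -> A (a *: v).
Proof. by move=> [h0 h] a v hv; rewrite -[_ *: _]addr0; apply: h. Qed.
Lemma subspB (A : U -> Prop) : subsp A -> forall v w, A v -> A w -> A (v - w).
Proof. by move=> [_ h] v w hv hw; rewrite addrC -scaleN1r; apply: h. Qed.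
Lemma subsp_sum (A : U -> Prop) : subsp A -> forall d (F : 'I_d -> U), (forall i, A (F i)) ->
  A (\sum_i F i).
Proof.
move=> hA d F hF; elim/big_ind: _ => //; [exact: subsp0 | exact: subspD].
Qed.

Definition lincomb d (c : 'I_d -> k) (b : 'I_d -> U) : U := \sum_j c j *: b j.
Definition lcat d m (b : 'I_d -> U) (u : 'I_m -> U) : 'I_(d + m) -> U :=
  fun i => match fintype.split i with inl a => b a | inr c => u c end.

Definition isbasis L M d (b : 'I_d -> U) :=
  [/\ forall j, L (b j),
      forall v, L v -> exists c, M (v - lincomb c b)
    & forall c, M (lincomb c b) -> forall j, c j = 0].
Definition ltrans M e (g : 'I_e -> U) d (b : 'I_d -> U) (P : 'M[k]_(d, e)) :=
  forall j, M (g j - lincomb (fun i => P i j) b).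

Lemma subsp_lincomb (A : U -> Prop) : subsp A -> forall d c (b : 'I_d -> U), (forall i, A (b i)) -> A (lincomb c b).
Proof. by move=> hA d c b hb; apply: subsp_sum => // i; apply: subspZ. Qed.

Lemma lincombB d (c c' : 'I_d -> k) b : lincomb c b - lincomb c' b = lincomb (fun i => c i - c' i) b.
Proof. by rewrite /lincomb -sumrB; apply: eq_bigr => i _; rewrite scalerBl. Qed.
Lemma eq_lincomb d (c c' : 'I_d -> k) b : c =1 c' -> lincomb c b = lincomb c' b.
Proof. by move=> h; apply: eq_bigr => i _; rewrite h. Qed.

Lemma lcat_l d m (b : 'I_d -> U) (u : 'I_m -> U) i : lcat b u (lshift m i) = b i.
Proof. by rewrite /lcat (unsplitK (inl _ i)). Qed.
Lemma lcat_r d m (b : 'I_d -> U) (u : 'I_m -> U) i : lcat b u (rshift d i) = u i.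
Proof. by rewrite /lcat (unsplitK (inr _ i)). Qed.
Lemma lincomb_lcat d m (b : 'I_d -> U) (u : 'I_m -> U) c :
  lincomb c (lcat b u) = lincomb (fun i => c (lshift m i)) b + lincomb (fun i => c (rshift d i)) u.
Proof.
rewrite /lincomb big_split_ord /=; congr (_ + _); apply: eq_bigr => i _.
  by rewrite lcat_l.
by rewrite lcat_r.
Qed.

Lemma trans_ex L M d (b : 'I_d -> U) e (g : 'I_e -> U) :
  isbasis L M b -> (forall j, L (g j)) -> exists P, ltrans M g b P.
Proof.
move=> [_ hs _] hg.
have [F hF] := choice (fun j => hs _ (hg j)).
exists (\matrix_(i, j) F j i) => j.
by under eq_lincomb do rewrite mxE; apply: hF.
Qed.

Lemma trans_uniq L M d (b : 'I_d -> U) e (g : 'I_e -> U) P Q : subsp M ->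
  isbasis L M b -> ltrans M g b P -> ltrans M g b Q -> P = Q.
Proof.
move=> hM [_ _ hi] hP hQ; apply/matrixP => i j; apply/eqP; rewrite -subr_eq0; apply/eqP.
apply: (hi (fun i => P i j - Q i j)).
by rewrite -lincombB; have := subspB hM (hQ j) (hP j); rewrite opprB addrC addrA subrK.
Qed.

Lemma trans_comp M d (b : 'I_d -> U) e (g : 'I_e -> U) f (h : 'I_f -> U) P Q : subsp M ->
  ltrans M g b P -> ltrans M h g Q -> ltrans M h b (P *m Q).
Proof.
move=> hM hP hQ j.
have -> : lincomb (fun i => (P *m Q) i j) b = \sum_l Q l j *: lincomb (fun i => P i l) b.
  rewrite /lincomb; under eq_bigr => i _ do rewrite mxE scaler_suml.
  rewrite exchange_big /=; apply: eq_bigr => l _; rewrite scaler_sumr.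
  by apply: eq_bigr => i _; rewrite scalerA mulrC.
rewrite -(subrK (lincomb (fun i => Q i j) g) (h j)) -addrA; apply: subspD => //.
rewrite /lincomb -sumrB; apply: subsp_sum => // l; rewrite -scalerBr; exact: subspZ.
Qed.

Lemma lincomb_delta d (b : 'I_d -> U) j : lincomb (fun i => (i == j)%:R) b = b j.
Proof.
rewrite /lincomb (bigD1 j) //= eqxx scale1r big1 ?addr0 // => i /negPf ->.
by rewrite scale0r.
Qed.

Lemma trans_id M d (b : 'I_d -> U) : subsp M -> ltrans M b b 1%:M.
Proof.
move=> hM j; under eq_lincomb do rewrite mxE.
by rewrite lincomb_delta subrr; exact: subsp0.
Qed.

Lemma trans_inv L M d (b : 'I_d -> U) e (g : 'I_e -> U) P Q : subsp M ->
  isbasis L M b -> ltrans M g b P -> ltrans M b g Q -> P *m Q = 1%:M.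
Proof.
move=> hM hb hP hQ; apply: (trans_uniq hM hb (trans_comp hM hP hQ)).
exact: trans_id.
Qed.

Lemma basis_size L M d (b : 'I_d -> U) e (g : 'I_e -> U) : subsp M ->
  isbasis L M b -> isbasis L M g -> d = e.
Proof.
move=> hM hb hg.
have [P hP] := trans_ex hb (let: And3 x _ _ := hg in x).
have [Q hQ] := trans_ex hg (let: And3 x _ _ := hb in x).
by apply/eqP; rewrite eqn_leq (mulmx1_min (trans_inv hM hb hP hQ))
  (mulmx1_min (trans_inv hM hg hQ hP)).
Qed.

Lemma sdetE d (P : 'M[k]_d) : sdet P = \det P.
Proof. by rewrite /sdet; case: eqP => // H; rewrite castmx_id. Qed.

(** Since [sdet] accepts any sizes, [g] and [b] need not be known to have equal length. The matrix
    picked by [epsilon] is unique by [trans_uniq] when [b] is a basis. *)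
Definition reldet M e (g : 'I_e -> U) d (b : 'I_d -> U) : k :=
  sdet (epsilon (inhabits 0) (fun P : 'M[k]_(d, e) => ltrans M g b P)).

Lemma reldetP L M d (b : 'I_d -> U) e (g : 'I_e -> U) P : subsp M ->
  isbasis L M b -> ltrans M g b P -> reldet M g b = sdet P.
Proof.
move=> hM hb hP; rewrite /reldet; congr sdet.
apply: (trans_uniq hM hb _ hP); apply: epsilon_spec; by exists P.
Qed.

Lemma reldet_mul L M d (b : 'I_d -> U) e (g : 'I_e -> U) f (h : 'I_f -> U) : subsp M ->
  isbasis L M b -> isbasis L M g -> isbasis L M h ->
  reldet M h b = reldet M h g * reldet M g b.
Proof.
move=> hM hb hg hh.
move: (basis_size hM hb hg) (basis_size hM hb hh) => *; subst e f.
have [P hP] := trans_ex hb (let: And3 x _ _ := hg in x).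
have [Q hQ] := trans_ex hg (let: And3 x _ _ := hh in x).
rewrite (reldetP hM hb hP) (reldetP hM hg hQ) (reldetP hM hb (trans_comp hM hP hQ)).
by rewrite !sdetE det_mulmx mulrC.
Qed.

Lemma reldet_id L M d (b : 'I_d -> U) : subsp M -> isbasis L M b -> reldet M b b = 1.
Proof. by move=> hM hb; rewrite (reldetP hM hb (trans_id b hM)) sdetE det1. Qed.

Lemma reldet_n0 L M d (b : 'I_d -> U) e (g : 'I_e -> U) : subsp M ->
  isbasis L M b -> isbasis L M g -> reldet M g b != 0.
Proof.
move=> hM hb hg; apply/eqP => h0.
have := reldet_mul hM hb hg hb; rewrite (reldet_id hM hb) h0 mulr0.
by move/eqP; rewrite oner_eq0.
Qed.

Lemma basis_cat L M (N : U -> Prop) d (b : 'I_d -> U) m (u : 'I_m -> U) : subsp M ->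
  subs M L -> subs N M -> isbasis L M b -> isbasis M N u -> isbasis L N (lcat b u).
Proof.
move=> hM sML sNM [b1 b2 b3] [u1 u2 u3]; split.
- move=> j; rewrite /lcat; case: (fintype.split j) => // a; exact/sML.
- move=> v /b2 [c /u2 [c' hc']].
  exists (fun i => match fintype.split i with inl a => c a | inr a => c' a end).
  rewrite lincomb_lcat opprD addrA.
  under eq_lincomb do rewrite (unsplitK (inl _ _)).
  by under [X in _ - _ - X]eq_lincomb do rewrite (unsplitK (inr _ _)).
- move=> c; rewrite lincomb_lcat => hc.
  have hu : M (lincomb (fun i => c (rshift d i)) u) by apply: subsp_lincomb.
  have hb : forall i, c (lshift m i) = 0.
    apply: (b3 (fun i => c (lshift m i))).
    by have := subspB hM (sNM _ hc) hu; rewrite addrK.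
  have hu0 : forall i, c (rshift d i) = 0.
    apply: (u3 (fun i => c (rshift d i))); move: hc.
    rewrite [X in X + _]/lincomb big1 ?add0r // => i _; by rewrite hb scale0r.
  by move=> j; rewrite -(splitK j); case: (fintype.split j) => a /=.
Qed.

(** Lifting [g] from modulo [M] to modulo [N] adds components along [v], collected in [X], while
    [v'] has none along [b]. The matrix is block triangular, so [X] does not affect its
    determinant. *)
Lemma trans_cat M (N : U -> Prop) d (b : 'I_d -> U) e (g : 'I_e -> U) m (v : 'I_m -> U)
    m' (v' : 'I_m' -> U) P B : subs N M -> subsp N ->
  isbasis M N v -> ltrans M g b P -> ltrans N v' v B ->
  exists X, ltrans N (lcat g v') (lcat b v) (block_mx P 0 X B).
Proof.
move=> sNM hN [v1 v2 v3] hP hB.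
have [F hF] := choice (fun j => v2 _ (hP j)).
exists (\matrix_(i, j) F j i) => j; rewrite lincomb_lcat -(splitK j).
case: (fintype.split j) => a /=.
  rewrite lcat_l; have := hF a.
  rewrite opprD addrA; congr (N (_ - _ - _)).
    by apply: eq_lincomb => i; rewrite block_mxEul.
  by apply: eq_lincomb => i; rewrite block_mxEdl mxE.
rewrite lcat_r [lincomb _ b]big1 => [|i _]; last by rewrite block_mxEur mxE scale0r.
rewrite add0r; have := hB a; congr (N (_ - _)).
by apply: eq_lincomb => i; rewrite block_mxEdr.
Qed.

Lemma reldet_cat L M (N : U -> Prop) d (b : 'I_d -> U) e (g : 'I_e -> U) m (v : 'I_m -> U)
    m' (v' : 'I_m' -> U) : subsp M -> subsp N -> subs M L -> subs N M ->
  isbasis L M b -> isbasis L M g -> isbasis M N v -> isbasis M N v' ->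
  reldet N (lcat g v') (lcat b v) = reldet M g b * reldet N v' v.
Proof.
move=> hM hN sML sNM hb hg hv hv'.
have [P hP] := trans_ex hb (let: And3 x _ _ := hg in x).
have [B hB] := trans_ex hv (let: And3 x _ _ := hv' in x).
have [X hX] := trans_cat sNM hN hv hP hB.
rewrite (reldetP hM hb hP) (reldetP hN hv hB).
rewrite (reldetP hN (basis_cat hM sML sNM hb hv) hX).
move: (basis_size hM hb hg) (basis_size hN hv hv') => *; subst e m'.
by rewrite !sdetE det_lblock.
Qed.

Lemma reldet_eqcast M d d' (E : d = d') (b : 'I_d -> U) (b' : 'I_d' -> U) L : subsp M ->
  isbasis L M b -> (forall i : 'I_d, b i = b' (cast_ord E i)) -> reldet M b' b = 1.
Proof.
move=> hM hb; subst d' => h.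
have -> : b' = b by apply/funext => i; rewrite h cast_ord_id.
exact: reldet_id hb.
Qed.

Lemma lcatA d m p (a : 'I_d -> U) (b : 'I_m -> U) (c : 'I_p -> U) (i : 'I_(d + m + p)) :
  lcat (lcat a b) c i = lcat a (lcat b c) (cast_ord (esym (addnA d m p)) i).
Proof.
rewrite -(splitK i); case: (fintype.split i) => [j|j] /=.
  rewrite lcat_l -(splitK j); case: (fintype.split j) => [l|l] /=.
    rewrite lcat_l.
    by rewrite (_ : cast_ord _ _ = lshift (m + p) l) ?lcat_l //; apply/val_inj.
  rewrite lcat_r.
  rewrite (_ : cast_ord _ _ = rshift d (lshift p l)) ?lcat_r ?lcat_l //; exact/val_inj.
rewrite lcat_r.
rewrite (_ : cast_ord _ _ = rshift d (rshift m j)) ?lcat_r ?lcat_r //.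
by apply/val_inj => /=; rewrite addnA.
Qed.

(** Both bases list the same vectors in the same order; only their index types differ, by the cast
    between [d + m + p] and [d + (m + p)]. *)
Lemma reldet_assoc L M d m p (a : 'I_d -> U) (b : 'I_m -> U) (c : 'I_p -> U) : subsp M ->
  isbasis L M (lcat (lcat a b) c) ->
  reldet M (lcat a (lcat b c)) (lcat (lcat a b) c) = 1.
Proof. by move=> hM hb; apply: (reldet_eqcast (E := esym (addnA d m p)) hM hb) => i; apply: lcatA. Qed.

Definition findim L M := exists d (b : 'I_d -> U), isbasis L M b.

Lemma findim_trans L M (N : U -> Prop) : subsp M -> subs M L -> subs N M -> findim L M -> findim M N -> findim L N.
Proof.
move=> h1 h2 h3 [d [b hb]] [m [u hu]]; exists (d + m)%N, (lcat b u).
exact: basis_cat hb hu.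
Qed.

Definition indep M e (g : 'I_e -> U) := forall c, M (lincomb c g) -> forall j, c j = 0.

(** A row vector killed by the transposed coordinate matrix would be a relation among the [g j]
    modulo [M], so that matrix has rank [e], which is at most [d]. *)
Lemma indep_le L M d (b : 'I_d -> U) e (g : 'I_e -> U) : subsp M ->
  isbasis L M b -> (forall j, L (g j)) -> indep M g -> (e <= d)%N.
Proof.
move=> hM hb hg hi.
have [P hP] := trans_ex hb hg.
suff fr : row_free P^T by rewrite -(eqP fr) rank_leq_col.
rewrite -kermx_eq0; apply/eqP/row_matrixP => i; rewrite row0.
apply/rowP => j; rewrite [RHS]mxE.
apply: (hi (fun j => row i (kermx P^T) 0 j)).
set r := row i _.
have hr : r *m P^T = 0 by apply/sub_kermxP; apply: row_sub.
clearbody r.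
have := subsp_sum hM (fun l => subspZ hM (r 0 l) (hP l)).
under eq_bigr do rewrite scalerBr; rewrite sumrB.
rewrite [X in _ - X](_ : _ = 0) ?subr0 //.
under eq_bigr do rewrite /lincomb scaler_sumr.
rewrite exchange_big big1 //= => l _.
under eq_bigr do rewrite scalerA; rewrite -scaler_suml.
have := congr1 (fun M : 'rV_d => M 0 l) hr; rewrite !mxE.
under eq_bigr do rewrite mxE.
by move=> ->; rewrite scale0r.
Qed.

(** Families in [A] independent modulo [C'] are independent modulo the smaller [C], so their length
    is bounded by the dimension of [B/C]. One of maximal length spans. *)
Lemma findim_sub (A B C C' : U -> Prop) : subsp A -> subsp C -> subsp C' ->
  findim B C -> subs A B -> subs C C' -> subs C' A -> findim A C'.
Proof.
move=> hA hC hC' [d [b hb]] sAB sCC sCA.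
pose Q e := `[< exists g : 'I_e -> U, (forall j, A (g j)) /\ indep C' g >].
have bound e : Q e -> (e <= d)%N.
  move=> /asboolP[g [g1 g2]]; apply: (indep_le hC hb (g := g)) => [j|c /sCC]; first exact: sAB.
  exact: g2.
have Q0 : exists e, Q e.
  exists 0%N; apply/asboolP; exists (fun _ => 0); split => [_|c _ []//]; exact: subsp0.
have [e /asboolP[g [g1 g2]] emax] := ex_maxnP Q0 bound.
exists e, g; split => // v hv.
apply: contrapT => hn.
suff : Q (e + 1)%N by move=> /emax; rewrite addn1 ltnn.
apply/asboolP; exists (lcat g (fun _ : 'I_1 => v)); split.
  by move=> j; rewrite /lcat; case: fintype.split.
move=> c; rewrite lincomb_lcat; set c1 := fun i => _; set x := lincomb _ (fun _ => v).
have -> : x = c (rshift e ord0) *: v by rewrite /x /lincomb big_ord1.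
have [c0|c0] := eqVneq (c (rshift e ord0)) 0.
  rewrite c0 scale0r addr0 => /g2 h j; rewrite -(splitK j); case: (fintype.split j) => a /=.
    exact: h.
  by rewrite ord1.
(* A relation with a nonzero coefficient on [v] can be solved for [v], which was assumed outside the
   span. *)
move=> h; case: hn; exists (fun i => - (c (rshift e ord0))^-1 * c1 i).
have := subspZ hC' (c (rshift e ord0))^-1 h.
rewrite scalerDr scalerA mulVf // scale1r addrC; congr (C' (_ + _)).
rewrite /lincomb -sumrN scaler_sumr; apply: eq_bigr => i _.
by rewrite scalerA mulNr scaleNr opprK.
Qed.

(** * Bases and transition matrices under injective linear maps *)

Section Image.
Variables (V : U -> Prop) (phi : U -> U).
Hypothesis hV : subsp V.
(** Relative to [V] because the maps to come use [lmul], whose algebraic laws are only available on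
    Laurent series, not on arbitrary functions [int -> k]. *)
Definition linon := forall a v w, V v -> V w -> phi (a *: v + w) = a *: phi v + phi w.
Definition injon := forall v w, V v -> V w -> phi v = phi w -> v = w.
Definition img L : U -> Prop := fun w => exists v, L v /\ w = phi v.
Hypotheses (hl : linon) (hi : injon).

Lemma lin0 : phi 0 = 0.
Proof.
have := hl 1 (subsp0 hV) (subsp0 hV); rewrite !scale1r addr0 => /eqP.
by rewrite -{1}[phi 0]addr0 (inj_eq (addrI _)) => /eqP <-.
Qed.
Lemma linZ a v : V v -> phi (a *: v) = a *: phi v.
Proof. by move=> hv; have := hl a hv (subsp0 hV); rewrite !addr0 lin0 addr0. Qed.
Lemma linD v w : V v -> V w -> phi (v + w) = phi v + phi w.
Proof. by move=> hv hw; have := hl 1 hv hw; rewrite !scale1r. Qed.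
Lemma linB v w : V v -> V w -> phi (v - w) = phi v - phi w.
Proof. by move=> hv hw; rewrite addrC -scaleN1r hl // scaleN1r addrC. Qed.
Lemma lin_lincomb d c (b : 'I_d -> U) : (forall i, V (b i)) -> phi (lincomb c b) = lincomb c (phi \o b).
Proof.
move=> hb; rewrite /lincomb.
suff [] : V (\sum_j c j *: b j) /\ phi (\sum_j c j *: b j) = \sum_j c j *: phi (b j) by [].
apply: (big_ind2 (fun x y => V x /\ phi x = y)).
- by rewrite lin0; split => //; apply: subsp0.
- by move=> x1 y1 x2 y2 [v1 <-] [v2 <-]; rewrite linD //; split=> //; apply: subspD.
- by move=> i _; rewrite linZ //; split=> //; apply: subspZ.
Qed.

Lemma img_subsp L : subsp L -> subs L V -> subsp (img L).
Proof.
move=> hL sLV; split; first by exists 0; rewrite lin0; split=> //; apply: subsp0.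
move=> a _ _ [v [hv ->]] [w [hw ->]]; exists (a *: v + w); rewrite hl; [|exact: sLV..].
by split => //; apply: (proj2 hL).
Qed.
Lemma img_subs L M : subs L M -> subs (img L) (img M).
Proof. by move=> h _ [v [hv ->]]; exists v; split => //; apply: h. Qed.

Lemma img_mem L v : V v -> subs L V -> img L (phi v) <-> L v.
Proof.
move=> hv sLV; split; last by exists v.
by move=> [w [hw /hi e]]; rewrite e //; apply: sLV.
Qed.

Lemma basis_img L M d (b : 'I_d -> U) : subs L V -> subs M V ->
  isbasis L M b -> isbasis (img L) (img M) (phi \o b).
Proof.
move=> sLV sMV [b1 b2 b3].
have bV i : V (b i) by apply/sLV/b1.
split.
- by move=> j; exists (b j).
- move=> _ [v [hv ->]]; have [c hc] := b2 _ hv; exists c.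
  rewrite -lin_lincomb // -linB; [|exact: sLV|exact: subsp_lincomb].
  by exists (v - lincomb c b).
- move=> c; rewrite -lin_lincomb // img_mem //; [exact: b3|exact: subsp_lincomb].
Qed.

Lemma trans_img M e (g : 'I_e -> U) d (b : 'I_d -> U) P :
  (forall i, V (g i)) -> (forall i, V (b i)) -> ltrans M g b P ->
  ltrans (img M) (phi \o g) (phi \o b) P.
Proof.
move=> hg hb hP j; rewrite -lin_lincomb // -linB //; last exact: subsp_lincomb.
by exists (g j - lincomb (fun i => P i j) b).
Qed.

End Image.

(** * A trivialisation of all relative determinants *)

Section Theta.
Variables (S : nat -> U -> Prop) (s : nat) (sigma : nat -> 'I_s -> U).
Hypotheses (Ssub : forall N, subsp (S N)) (Sdec : forall N, subs (S N.+1) (S N))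
  (Sbasis : forall N, isbasis (S N) (S N.+1) (sigma N)).

Lemma S_anti N N' : (N <= N')%N -> subs (S N') (S N).
Proof.
elim: N' => [|N' IH]; first by rewrite leqn0 => /eqP ->.
rewrite leq_eqVlt => /predU1P[-> //|]; rewrite ltnS => /IH h v /Sdec; exact: h.
Qed.
Lemma S_findim N N' : (N <= N')%N -> findim (S N) (S N').
Proof.
elim: N' => [|N' IH].
  rewrite leqn0 => /eqP ->; exists 0%N, (fun _ => 0); split => [[]//|v hv|c _ []//].
  by exists (fun _ => 0); rewrite /lincomb big_ord0 subr0.
rewrite leq_eqVlt => /predU1P[->|].
  exists 0%N, (fun _ => 0); split => [[]//|v hv|c _ []//].
  by exists (fun _ => 0); rewrite /lincomb big_ord0 subr0.
rewrite ltnS => le; apply: (findim_trans (M := S N')) (IH le) _ => //; first exact: S_anti.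
by exists s, (sigma N').
Qed.

Definition cspace L := subsp L /\ exists N, subs (S N) L /\ findim L (S N).

Lemma cspace_ge L : cspace L -> exists N0, forall N, (N0 <= N)%N -> subs (S N) L /\ findim L (S N).
Proof.
move=> [hL [N0 [s0 f0]]]; exists N0 => N le; split.
  by move=> v /(S_anti le) /s0.
apply: findim_trans s0 _ f0 (S_findim le) => //; exact: S_anti.
Qed.

Lemma cspace_findim L M : cspace L -> cspace M -> subs M L -> findim L M.
Proof.
move=> cL cM sML; have [N1 h1] := cspace_ge cL; have [N2 h2] := cspace_ge cM.
have [_ f] := h1 _ (leq_maxl N1 N2); have [g _] := h2 _ (leq_maxr N1 N2).
by apply: findim_sub f _ g _ => //; [case: cL|case: cM].
Qed.

Let fam := {d : nat & 'I_d -> U}.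
Let fam0 : fam := existT _ 0%N (fun _ => 0).
Definition cat_fam (f g : fam) : fam := existT _ _ (lcat (projT2 f) (projT2 g)).
(* A level [N] with [S N] inside [L] and a basis of [L / S N]; from that level on,
   [fr L N'] extends it by the bases [sigma] of the successive quotients. *)
Definition lv_frame L : nat * fam := epsilon (inhabits (0%N, fam0))
  (fun p => subs (S p.1) L /\ isbasis L (S p.1) (projT2 p.2)).
Definition lv L := (lv_frame L).1.
Fixpoint frame L N : fam := match N with
  | 0 => (lv_frame L).2
  | N'.+1 => if (lv L <= N')%N then cat_fam (frame L N') (existT _ s (sigma N')) else (lv_frame L).2
  end.
Definition fr L N := projT2 (frame L N).
Arguments fr : clear implicits.

Lemma frameP L N : cspace L -> (lv L <= N)%N -> subs (S N) L /\ isbasis L (S N) (fr L N).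
Proof.
move=> [hL [N0 [s0 [d [b f0]]]]].
have : subs (S (lv L)) L /\ isbasis L (S (lv L)) (projT2 (lv_frame L).2).
  by apply: (epsilon_spec (inhabits (0%N, fam0)) (fun p => subs (S p.1) L /\ isbasis L (S p.1) (projT2 p.2))); exists (N0, existT _ d b).
move=> [s1 f1]; elim: N => [|N IH].
  by rewrite leqn0 => /eqP e; rewrite /fr /=; rewrite e in s1 f1.
rewrite leq_eqVlt ltnS /fr /=; case: ifP => [le _|].
  have [s2 f2] := IH le; split; first by move=> v /Sdec /s2.
  exact: basis_cat f2 _.
by move=> _ /orP[/eqP e|//]; rewrite -e.
Qed.

(* For [N] large this does not depend on [N]. *)
Definition thetaN N L M d (h : 'I_d -> U) := reldet (S N) (lcat h (fr M N)) (fr L N).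
Definition theta L M d (h : 'I_d -> U) := thetaN (maxn (lv L) (lv M)) L M h.

(** Raising [N] by one appends [sigma N] to both families. The new transition matrix is block
    triangular with an identity block, so the determinant is unchanged. *)
Lemma thetaE N L M d (h : 'I_d -> U) : cspace L -> cspace M -> subs M L -> isbasis L M h ->
  (lv L <= N)%N -> (lv M <= N)%N -> theta L M h = thetaN N L M h.
Proof.
move=> cL cM sML hh; rewrite /theta => l1 l2.
have : (maxn (lv L) (lv M) <= N)%N by rewrite geq_max l1.
elim: N {l1 l2} => [|N IH]; first by rewrite leqn0 => /eqP ->.
rewrite leq_eqVlt => /predU1P[-> //|]; rewrite ltnS => le; rewrite IH //.
move: le; rewrite geq_max => /andP[l1 l2].
have [s1 f1] := frameP cL l1; have [s2 f2] := frameP cM l2.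
have [hM _] := cM.
rewrite /thetaN /fr /= l1 l2 /=; rewrite -!/(fr _ _).
have bLN : isbasis L (S N) (lcat h (fr M N)) by apply: basis_cat f2.
have bb : isbasis L (S N.+1) (lcat (lcat h (fr M N)) (sigma N)) by apply: basis_cat bLN _.
rewrite (reldet_mul (Ssub _) _ bb); last first.
- apply: (basis_cat hM) hh _ => //; first by move=> v /Sdec; exact: s2.
  exact: basis_cat f2 _.
- exact: basis_cat f1 _.
rewrite (reldet_assoc (Ssub _) bb) mul1r.
rewrite (reldet_cat (Ssub N) (Ssub _) s1) //.
by rewrite (reldet_id (Ssub _) (Sbasis N)) mulr1.
Qed.

Lemma theta_n0 L M d (h : 'I_d -> U) : cspace L -> cspace M -> subs M L -> isbasis L M h ->
  theta L M h != 0.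
Proof.
move=> cL cM sML hh; have [hM _] := cM.
have [s1 f1] := frameP cL (leq_maxl _ (lv M)); have [s2 f2] := frameP cM (leq_maxr (lv L) _).
apply: reldet_n0 f1 _ => //; exact: basis_cat f2.
Qed.

Lemma theta_change L M d (h : 'I_d -> U) e (g : 'I_e -> U) :
  cspace L -> cspace M -> subs M L -> isbasis L M h -> isbasis L M g ->
  theta L M g = theta L M h * reldet M g h.
Proof.
move=> cL cM sML hh hg; have [hM _] := cM.
have [s1 f1] := frameP cL (leq_maxl _ (lv M)); have [s2 f2] := frameP cM (leq_maxr (lv L) _).
rewrite /theta /thetaN; set N := maxn _ _ in s1 f1 s2 f2 *.
rewrite (reldet_mul (Ssub N) f1 (basis_cat hM sML s2 hh f2) (basis_cat hM sML s2 hg f2)).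
rewrite (reldet_cat hM (Ssub N) sML s2) // mulrC; congr (_ * _).
by rewrite (reldet_id (Ssub N) f2) mulr1.
Qed.

(** At a common level [N], pass from the frame of [L] to [h] followed by the frame of [M]; replacing
    the latter by [u] followed by the frame of [M'] contributes exactly [theta M M' u]. Rebracketing
    costs a determinant equal to 1. *)
Lemma theta_cat L M M' d (h : 'I_d -> U) e (u : 'I_e -> U) :
  cspace L -> cspace M -> cspace M' -> subs M L -> subs M' M -> isbasis L M h -> isbasis M M' u ->
  theta L M' (lcat h u) = theta L M h * theta M M' u.
Proof.
move=> cL cM cM' s1 s2 hh hu; have [hM _] := cM; have [hM' _] := cM'.
pose N := maxn (lv L) (maxn (lv M) (lv M')).
have lL : (lv L <= N)%N by rewrite leq_maxl.
have lM : (lv M <= N)%N by rewrite !leq_max leqnn orbT.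
have lM' : (lv M' <= N)%N by rewrite !leq_max leqnn !orbT.
have [sL fL] := frameP cL lL; have [sM fM] := frameP cM lM; have [sM' fM'] := frameP cM' lM'.
have hc := basis_cat hM s1 s2 hh hu.
have s12 : subs M' L by move=> v /s2 /s1.
rewrite (thetaE (N := N) cL cM' s12) // (thetaE (N := N) cL cM) // (thetaE (N := N) cM cM') //.
rewrite /thetaN.
have b0 := basis_cat hM' s12 sM' hc fM'.
have bu := basis_cat hM' s2 sM' hu fM'.
have b1 := basis_cat hM s1 sM hh bu.
have b2 := basis_cat hM s1 sM hh fM.
rewrite (reldet_mul (Ssub N) fL b2 b0) mulrC; congr (_ * _).
have := reldet_assoc (Ssub N) b0; rewrite (reldet_mul (Ssub N) b0 b2 b1) => h1.
have h2 := reldet_mul (Ssub N) b2 b0 b2; rewrite (reldet_id (Ssub N) b2) in h2.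
move: h1; rewrite (reldet_cat hM (Ssub N) s1 sM hh hh fM bu).
rewrite (reldet_id hM hh) mul1r => h1.
have hz := reldet_n0 (Ssub N) b0 b2.
by apply: (mulIf hz); rewrite h1 mulrC -h2.
Qed.
End Theta.
End LinAlg.

(** * Laurent series *)

Section Laurent.
Variable k : fieldType.
Implicit Types (f g h : laur k).

Definition supp f (a : int) := forall i : int, i < a -> f i = 0.

Lemma suppW f a a' : a' <= a -> supp f a -> supp f a'.
Proof. by move=> le h i hi; apply/h/(lt_le_trans hi). Qed.
Lemma laurent_supp f a : supp f a -> is_laurent f. Proof. by exists a. Qed.
Lemma lo_supp f : is_laurent f -> supp f (lo f).
Proof. exact: epsilon_spec. Qed.

Definition window f g (a : int) D (m : int) := \sum_(j < D) f (a + j%:Z) * g (m - a - j%:Z).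

Lemma window_extend f g a b D e m : supp g b -> m - a - b < D%:Z ->
  window f g a (D + e) m = window f g a D m.
Proof.
move=> hg hD; rewrite /window big_split_ord /= [X in _ + X]big1 ?addr0 // => j _.
rewrite (hg (_ - _)) ?mulr0 //; lia.
Qed.

Lemma window_shift f g a n D m : supp f (a + n%:Z) ->
  window f g a (n + D) m = window f g (a + n%:Z) D m.
Proof.
move=> hf; rewrite /window big_split_ord /= big1 ?add0r => [|j _].
  apply: eq_bigr => j _; congr (f _ * g _); lia.
by rewrite hf ?mul0r //; have := ltn_ord j; lia.
Qed.

Lemma window_eq f g a a' b b' D D' m : supp f a -> supp g b -> supp f a' -> supp g b' ->
  m - a - b < D%:Z -> m - a' - b' < D'%:Z -> window f g a D m = window f g a' D' m.
Proof.
wlog le : a a' b b' D D' / a <= a'.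
  move=> hw; have [le|/ltW le] := leP a a'; first exact: hw.
  by move=> *; symmetry; apply: (hw a' a b' b).
have [n ->] : exists n : nat, a' = a + n%:Z by exists (absz (a' - a)%R); lia.
move=> fa gb fa' gb' h h'.
rewrite -(window_extend f (n + D') gb h) -(window_extend f 0 gb' h') addn0.
rewrite -window_shift // addnC.
by rewrite (window_extend f _ gb') //; lia.
Qed.

(** Frees computations from [lo], an arbitrary lower bound chosen by [epsilon]: terms in front of a
    window vanish by the support of [f], terms behind it by the support of [g]. *)
Lemma lmul_window f g a b D m : supp f a -> supp g b -> m - a - b < D%:Z ->
  lmul f g m = window f g a D m.
Proof.
move=> fa gb h.
have fl := lo_supp (laurent_supp fa); have gl := lo_supp (laurent_supp gb).
rewrite /lmul; case: ifP => hm.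
  by apply: (window_eq (b := lo g) (b' := b)) => //; lia.
rewrite -(@window_eq f g (lo f) a (lo g) b 0 D m) //; last lia.
by rewrite /window big_ord0.
Qed.

Lemma supp_mul f g a b : supp f a -> supp g b -> supp (lmul f g) (a + b).
Proof.
move=> fa gb m hm; rewrite (lmul_window (D := 0) fa gb) /window ?big_ord0 //; lia.
Qed.

Lemma laurent_mul f g : is_laurent f -> is_laurent g -> is_laurent (lmul f g).
Proof. by move=> [a ha] [b hb]; exists (a + b); apply: supp_mul. Qed.

Definition trunc f (a : int) D : {poly k} := \poly_(i < D) f (a + i%:Z).

(* The first coefficients of a product are those of a product of polynomials,
   which transfers the ring axioms. *)
Lemma lmul_trunc f g a b D (n : nat) : supp f a -> supp g b -> (n < D)%N ->
  lmul f g (a + b + n%:Z) = (trunc f a D * trunc g b D)`_n.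
Proof.
move=> fa gb nD; rewrite (lmul_window (D := n.+1) fa gb); last lia.
rewrite coefM /window; apply: eq_bigr => j _; have jn := ltn_ord j.
rewrite !coef_poly (leq_ltn_trans _ nD) ?(leq_ltn_trans (leq_subr _ _) nD) //.
by congr (_ * g _); lia.
Qed.

Lemma coefM_eq (p p' r r' : {poly k}) n : (forall j, (j <= n)%N -> p`_j = p'`_j) ->
  (forall j, (j <= n)%N -> r`_j = r'`_j) -> (p * r)`_n = (p' * r')`_n.
Proof.
move=> h1 h2; rewrite !coefM; apply: eq_bigr => j _.
by have jn := ltn_ord j; rewrite h1 ?h2 ?leq_subr // -ltnS.
Qed.

Lemma lmulA f g h : is_laurent f -> is_laurent g -> is_laurent h ->
  lmul f (lmul g h) = lmul (lmul f g) h.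
Proof.
move=> [a fa] [b gb] [c hc]; apply/funext => m.
have [hm|hm] := ltP m (a + b + c).
  rewrite (supp_mul (supp_mul fa gb) hc) //.
  by rewrite (supp_mul fa (supp_mul gb hc)) // addrA.
have [n ->] : exists n : nat, m = a + b + c + n%:Z by exists (absz (m - (a + b + c))%R); lia.
rewrite (lmul_trunc (supp_mul fa gb) hc (ltnSn n)).
rewrite -(addrA a) (lmul_trunc fa (supp_mul gb hc) (ltnSn n)).
transitivity ((trunc f a n.+1 * (trunc g b n.+1 * trunc h c n.+1))`_n).
  apply: coefM_eq => // j jn.
  by rewrite [LHS]coef_poly ltnS jn (lmul_trunc gb hc (D := n.+1)).
rewrite mulrA; apply: coefM_eq => // j jn.
by rewrite [RHS]coef_poly ltnS jn (lmul_trunc fa gb (D := n.+1)).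
Qed.

Lemma lmulC f g : is_laurent f -> is_laurent g -> lmul f g = lmul g f.
Proof.
move=> [a fa] [b gb]; apply/funext => m.
have [hm|hm] := ltP m (a + b).
  by rewrite (supp_mul fa gb) // (supp_mul gb fa) // addrC.
have [n ->] : exists n : nat, m = a + b + n%:Z by exists (absz (m - (a + b))%R); lia.
rewrite (lmul_trunc fa gb (ltnSn n)) [a + b]addrC (lmul_trunc gb fa (ltnSn n)).
by rewrite mulrC.
Qed.

Lemma lmul_linr f g h x : is_laurent f -> is_laurent g -> is_laurent h ->
  lmul f (fun i => x * g i + h i) = fun i => x * lmul f g i + lmul f h i.
Proof.
move=> [a fa] [b gb] [c hc]; apply/funext => m.
pose d := Order.min b c.
have gd : supp g d by apply: suppW gb; rewrite /d; lia.
have hd : supp h d by apply: suppW hc; rewrite /d; lia.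
have ghd : supp (fun i => x * g i + h i) d by move=> i hi; rewrite gd // hd // mulr0 addr0.
pose D := (absz (m - a - d)%R).+1; have hD : m - a - d < D%:Z by rewrite /D; lia.
rewrite (lmul_window fa gd hD) (lmul_window fa hd hD) (lmul_window fa ghd hD).
rewrite /window mulr_sumr -big_split /=; apply: eq_bigr => j _; ring.
Qed.

Lemma supp_mono (x : k) r : supp (lmono x r) r.
Proof. by move=> i /lt_eqF; rewrite /lmono => ->. Qed.
Lemma supp_const (x : k) : supp (lconst x) 0.
Proof. exact: supp_mono. Qed.

Lemma lmul_mono x (r : int) f : is_laurent f -> lmul (lmono x r) f = fun m => x * f (m - r).
Proof.
move=> [b fb]; apply/funext => m.
have hr := @supp_mono x r.
pose D := (absz (m - r - b)%R).+1.
rewrite (lmul_window (D := D) hr fb); last by rewrite /D; lia.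
rewrite /window /D big_ord_recl big1 ?addr0 => [|j _].
  by rewrite /= ?addr0 ?subr0 /lmono eqxx.
rewrite lift0 /lmono ifF ?mul0r //; apply/negP => /eqP; lia.
Qed.

Lemma lmul_const x f : is_laurent f -> lmul (lconst x) f = fun m => x * f m.
Proof. by move=> hf; rewrite [LHS](lmul_mono x 0 hf); apply/funext => m; rewrite subr0. Qed.

Lemma lsig_mul q f g : q != 0 -> is_laurent f -> is_laurent g ->
  lsig q (lmul f g) = lmul (lsig q f) (lsig q g).
Proof.
move=> q0 [a fa] [b gb]; apply/funext => m.
have fa' : supp (lsig q f) a by move=> i hi; rewrite /lsig fa // mulr0.
have gb' : supp (lsig q g) b by move=> i hi; rewrite /lsig gb // mulr0.
pose D := (absz (m - a - b)%R).+1; have hD : m - a - b < D%:Z by rewrite /D; lia.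
rewrite /lsig -!/(lsig q _) (lmul_window fa gb hD) (lmul_window fa' gb' hD).
rewrite /window mulr_sumr; apply: eq_bigr => j _; rewrite /lsig.
rewrite {1}(_ : m = (a + j%:Z) + (m - a - j%:Z)); last lia.
rewrite expfzDr //; ring.
Qed.

(** A subtype, because [laur] also contains functions unbounded to the left, for which [lmul] has no
    meaning; on [lser] the product makes a commutative ring. *)
Definition lser := {f : laur k | `[< is_laurent f >]}.
Definition lval (x : lser) : laur k := sval x.

Lemma lvalP (x : lser) : is_laurent (lval x). Proof. by case: x => f /= /asboolP. Qed.
Definition mkl f (hf : is_laurent f) : lser := exist _ f (introT (asboolP _) hf).
Lemma lval_inj : injective lval.
Proof. move=> [f hf] [g hg] /= e; subst g; congr exist; exact: Prop_irrelevance. Qed.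

Lemma laurent0 : is_laurent (lzero k). Proof. by exists 0. Qed.
Lemma laurentD f g : is_laurent f -> is_laurent g -> is_laurent (ladd f g).
Proof.
move=> [a fa] [b gb]; exists (Order.min a b) => i hi; rewrite /ladd fa ?gb ?addr0 //; lia.
Qed.
Lemma laurentZ x f : is_laurent f -> is_laurent (fun i => x * f i).
Proof. by move=> [a fa]; exists a => i hi; rewrite fa // mulr0. Qed.
Lemma laurentN f : is_laurent f -> is_laurent (fun i => - f i).
Proof. by move=> [a fa]; exists a => i hi; rewrite fa // oppr0. Qed.
Lemma laurent_const (x : k) : is_laurent (lconst x).
Proof. exact: laurent_supp (supp_const x). Qed.

HB.instance Definition _ := gen_eqMixin lser.
HB.instance Definition _ := gen_choiceMixin lser.

Definition lser_zero := mkl laurent0.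
Definition lser_one := mkl (laurent_const 1).
Definition lser_add (x y : lser) := mkl (laurentD (lvalP x) (lvalP y)).
Definition lser_opp (x : lser) := mkl (laurentN (lvalP x)).
Definition lser_mul (x y : lser) := mkl (laurent_mul (lvalP x) (lvalP y)).

Lemma lser_addA : associative lser_add.
Proof. by move=> x y z; apply/lval_inj/funext => i; apply: addrA. Qed.
Lemma lser_addC : commutative lser_add.
Proof. by move=> x y; apply/lval_inj/funext => i; apply: addrC. Qed.
Lemma lser_add0 : left_id lser_zero lser_add.
Proof. by move=> x; apply/lval_inj/funext => i; apply: add0r. Qed.
Lemma lser_addN : left_inverse lser_zero lser_opp lser_add.
Proof. by move=> x; apply/lval_inj/funext => i; apply: addNr. Qed.
HB.instance Definition _ := GRing.isZmodule.Build lser lser_addA lser_addC lser_add0 lser_addN.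

Lemma lser_mulA : associative lser_mul.
Proof. by move=> x y z; apply/lval_inj/lmulA; apply: lvalP. Qed.
Lemma lser_mulC : commutative lser_mul.
Proof. by move=> x y; apply/lval_inj/lmulC; apply: lvalP. Qed.
Lemma lser_mul1 : left_id lser_one lser_mul.
Proof.
move=> x; apply/lval_inj; rewrite [LHS](lmul_const 1 (lvalP x)); apply/funext => m.
exact: mul1r.
Qed.
Lemma lser_mulD : left_distributive lser_mul lser_add.
Proof.
move=> x y z; apply/lval_inj; rewrite !(lser_mulC _ z).
have := lmul_linr 1 (lvalP z) (lvalP x) (lvalP y).
under eq_fun do rewrite mul1r; move=> h; rewrite [LHS]h.
by under eq_fun do rewrite mul1r.
Qed.
Lemma lser_1neq0 : lser_one != 0 :> lser.
Proof.
apply/eqP => /(congr1 (fun x => lval x 0)); rewrite /= /lconst eqxx => /eqP.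
by rewrite oner_eq0.
Qed.
HB.instance Definition _ := GRing.Zmodule_isComNzRing.Build lser
  lser_mulA lser_mulC lser_mul1 lser_mulD lser_1neq0.

(** * Matrices over Laurent series and the action of [sigma_q] *)

Lemma lval_sum (J : finType) (F : J -> lser) : lval (\sum_j F j) = lsum (fun j => lval (F j)).
Proof.
apply/funext => m; rewrite /lsum.
by elim/big_rec2: _ => //= j x y _ <-.
Qed.

(** Moves identities between matrices into [lser], where the ring and big-operator lemmas apply. *)
Lemma lift_mat (I J : finType) (A : mat k I J) : is_mat A ->
  exists A' : I -> J -> lser, A = fun i j => lval (A' i j).
Proof. by move=> hA; exists (fun i j => mkl (hA i j)). Qed.
Lemma lift_vec (I : finType) (v : vec k I) : is_vec v ->
  exists v' : I -> lser, v = fun i => lval (v' i).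
Proof. by move=> hv; exists (fun i => mkl (hv i)). Qed.

Lemma matmul_lift (I J L : finType) (A : I -> J -> lser) (B : J -> L -> lser) :
  matmul (fun i j => lval (A i j)) (fun i j => lval (B i j)) =
  fun i l => lval (\sum_j A i j * B j l).
Proof. by apply/funext => i; apply/funext => l; rewrite lval_sum. Qed.
Lemma matvec_lift (I J : finType) (A : I -> J -> lser) (v : J -> lser) :
  matvec (fun i j => lval (A i j)) (fun i => lval (v i)) =
  fun i => lval (\sum_j A i j * v j).
Proof. by apply/funext => i; rewrite lval_sum. Qed.
Lemma mat1_lift (I : finType) : @mat1 k I = fun i j => lval (i == j)%:R.
Proof. by apply/funext => i; apply/funext => j; rewrite /mat1; case: eqP. Qed.

Lemma is_mat_mul (I J L : finType) (A : mat k I J) (B : mat k J L) :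
  is_mat A -> is_mat B -> is_mat (matmul A B).
Proof.
by move=> /lift_mat[A' ->] /lift_mat[B' ->]; rewrite matmul_lift => i j; apply: lvalP.
Qed.
Lemma is_vec_matvec (I J : finType) (A : mat k I J) v :
  is_mat A -> is_vec v -> is_vec (matvec A v).
Proof.
by move=> /lift_mat[A' ->] /lift_vec[B' ->]; rewrite matvec_lift => i; apply: lvalP.
Qed.
Lemma is_mat1 (I : finType) : is_mat (@mat1 k I).
Proof. by rewrite mat1_lift => i j; apply: lvalP. Qed.

Lemma matmulA (I J L M : finType) (A : mat k I J) (B : mat k J L) (C : mat k L M) :
  is_mat A -> is_mat B -> is_mat C -> matmul A (matmul B C) = matmul (matmul A B) C.
Proof.
move=> /lift_mat[A' ->] /lift_mat[B' ->] /lift_mat[C' ->]; rewrite !matmul_lift.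
apply/funext => i; apply/funext => l; congr lval.
under eq_bigr do rewrite mulr_sumr; rewrite exchange_big.
by apply: eq_bigr => j _; rewrite mulr_suml; apply: eq_bigr => j' _; rewrite mulrA.
Qed.
Lemma matvecA (I J L : finType) (A : mat k I J) (B : mat k J L) v :
  is_mat A -> is_mat B -> is_vec v -> matvec A (matvec B v) = matvec (matmul A B) v.
Proof.
move=> /lift_mat[A' ->] /lift_mat[B' ->] /lift_vec[v' ->].
rewrite matmul_lift !matvec_lift; apply/funext => i; congr lval.
under eq_bigr do rewrite mulr_sumr; rewrite exchange_big.
by apply: eq_bigr => j _; rewrite mulr_suml; apply: eq_bigr => j' _; rewrite mulrA.
Qed.
Lemma sum_delta (I : finType) (R : pzRingType) (F : I -> R) i : \sum_j (i == j)%:R * F j = F i.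
Proof.
rewrite (bigD1 i) //= eqxx mul1r big1 ?addr0 // => j; rewrite eq_sym => /negPf ->.
by rewrite mul0r.
Qed.
Lemma matmul1m (I J : finType) (A : mat k I J) : is_mat A -> matmul (@mat1 k I) A = A.
Proof.
move=> /lift_mat[A' ->]; rewrite mat1_lift matmul_lift.
by apply/funext => i; apply/funext => j; rewrite sum_delta.
Qed.
Lemma matmulm1 (I J : finType) (A : mat k I J) : is_mat A -> matmul A (@mat1 k J) = A.
Proof.
move=> /lift_mat[A' ->]; rewrite mat1_lift matmul_lift.
apply/funext => i; apply/funext => j; rewrite -[in RHS](sum_delta (A' i) j); congr lval.
by apply: eq_bigr => l _; rewrite mulrC eq_sym.
Qed.
Lemma matvec1 (I : finType) (v : vec k I) : is_vec v -> matvec (@mat1 k I) v = v.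
Proof.
move=> /lift_vec[v' ->]; rewrite mat1_lift matvec_lift.
by apply/funext => i; rewrite sum_delta.
Qed.

Lemma matvec_lin (I J : finType) (A : mat k I J) x (v w : J -> int -> k^o) :
  is_mat A -> is_vec v -> is_vec w ->
  matvec A (x *: v + w : J -> int -> k^o) =
    (x *: (matvec A v : I -> int -> k^o) + matvec A w :> (I -> int -> k^o)).
Proof.
move=> hA hv hw; apply/funext => i; apply/funext => m.
rewrite /matvec /lsum [RHS](_ : _ = x * (\sum_j lmul (A i j) (v j) m)
   + \sum_j lmul (A i j) (w j) m) // mulr_sumr -big_split /=.
apply: eq_bigr => j _.
by have /(congr1 (fun f => f m)) := lmul_linr x (hA i j) (hv j) (hw j).
Qed.

Lemma lsig_supp q f a : supp f a -> supp (lsig q f) a.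
Proof. by move=> h i hi; rewrite /lsig h // mulr0. Qed.
Lemma is_mat_sig q (I J : finType) (A : mat k I J) : is_mat A -> is_mat (msig q A).
Proof. by move=> hA i j; case: (hA i j) => a h; exists a; apply: lsig_supp. Qed.
Lemma is_vec_sig q (I : finType) (v : vec k I) : is_vec v -> is_vec (vsig q v).
Proof. by move=> hA i; case: (hA i) => a h; exists a; apply: lsig_supp. Qed.

Lemma lsig_lsum q (J : finType) (F : J -> laur k) :
  lsig q (lsum F) = lsum (fun j => lsig q (F j)).
Proof. by apply/funext => m; rewrite /lsig /lsum mulr_sumr. Qed.

Lemma msig_mul q (I J L : finType) (A : mat k I J) (B : mat k J L) : q != 0 ->
  is_mat A -> is_mat B -> msig q (matmul A B) = matmul (msig q A) (msig q B).
Proof.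
move=> q0 hA hB; apply/funext => i; apply/funext => j.
rewrite /msig /matmul lsig_lsum; congr lsum; apply/funext => l.
exact: lsig_mul.
Qed.
Lemma vsig_matvec q (I J : finType) (A : mat k I J) v : q != 0 ->
  is_mat A -> is_vec v -> vsig q (matvec A v) = matvec (msig q A) (vsig q v).
Proof.
move=> q0 hA hB; apply/funext => i.
rewrite /vsig /matvec lsig_lsum; congr lsum; apply/funext => l.
exact: lsig_mul.
Qed.
Lemma msig1 q (I : finType) : msig q (@mat1 k I) = @mat1 k I.
Proof.
apply/funext => i; apply/funext => j; apply/funext => m; rewrite /msig /mat1 /lsig.
case: eqP => _; last by rewrite /lzero mulr0.
by rewrite /lconst; case: eqP => [->|_]; rewrite ?expr0z ?mul1r ?mulr0.
Qed.

Lemma mat_ext (I J : finType) (A B : mat k I J) : is_mat A -> is_mat B ->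
  (forall v, is_vec v -> matvec A v = matvec B v) -> A = B.
Proof.
move=> /lift_mat[A' ->] /lift_mat[B' ->] h.
apply/funext => i; apply/funext => j.
have := h (fun l => lval (l == j)%:R) (fun l => lvalP _).
rewrite !matvec_lift => /(congr1 (@^~ i)) /=.
have E (C : I -> J -> lser) : \sum_l C i l * (l == j)%:R = C i j.
  by rewrite -[RHS](sum_delta (C i) j); apply: eq_bigr => l _; rewrite mulrC eq_sym.
by rewrite !E.
Qed.

(** Enumerating [I] and [J] gives a factorisation of an identity matrix over the commutative ring
    [lser], and its size is bounded by the inner dimension. *)
Lemma inverse_card (I J : finType) (Y : mat k I J) (Z : mat k J I) : is_mat Y -> is_mat Z ->
  matmul Y Z = @mat1 k I -> (#|I| <= #|J|)%N.
Proof.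
move=> /lift_mat[Y' ->] /lift_mat[Z' ->]; rewrite matmul_lift mat1_lift => h.
apply: (@mulmx1_min lser _ _ (\matrix_(i, j) Y' (enum_val i) (enum_val j))
  (\matrix_(i, j) Z' (enum_val i) (enum_val j))).
apply/matrixP => i j; rewrite !mxE.
have := congr1 (fun F : mat k I I => F (enum_val i) (enum_val j)) h => /lval_inj.
rewrite (inj_eq enum_val_inj) => <-; rewrite (reindex (fun l : 'I_#|J| => enum_val l)) /=.
  by apply: eq_bigr => l _; rewrite !mxE.
by apply: onW_bij; apply: enum_val_bij.
Qed.
End Laurent.

(** * Coordinates on determinant lines *)

Section DetLine.
Variables (k : fieldType) (n : nat).
(** The ambient space consists of all functions, so that [vec k 'I_n] is its carrier on the nose and
    no coercion intervenes; Laurent vectors form a subspace of it. *)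
Definition kvec : lmodType k := ('I_n -> int -> k^o).
Local Notation subsp := (@subsp k kvec).
Local Notation subs := (@subs k kvec).
Local Notation isbasis := (@isbasis k kvec).
Local Notation ltrans := (@ltrans k kvec).
Local Notation reldet := (@reldet k kvec).
Local Notation img := (@img k kvec).
Local Notation linon := (@linon k kvec).
Local Notation vset := (vset k n).
Local Notation detfun := (detfun k n).
Implicit Types (L M : vset) (w : detfun) (phi psi : kvec -> kvec).

Lemma kcombE d (c : 'I_d -> k) (b : 'I_d -> kvec) : kcomb c b = lincomb c b.
Proof.
by apply/funext => i; apply/funext => m; rewrite /kcomb /lincomb !fct_sumE.
Qed.
Lemma basis_modE L M d (b : 'I_d -> kvec) : basis_mod L M b <-> isbasis L M b.
Proof.
split => [[h1 h2 h3]|[h1 h2 h3]]; split => //.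
- by move=> v /h2 [c]; rewrite kcombE => hc; exists c.
- by move=> c; rewrite -kcombE; apply: h3.
- by move=> v /h2 [c hc]; exists c; rewrite kcombE.
- by move=> c; rewrite kcombE; apply: h3.
Qed.
Lemma transE M e (g : 'I_e -> kvec) d (b : 'I_d -> kvec) P : trans M g b P <-> ltrans M g b P.
Proof. by split => h j; have := h j; rewrite kcombE. Qed.

(** This is [t^a k[[t]]^n], and [unitvec a j] below is [t^a e_j]. *)
Definition tlat (a : int) : vset := fun v => forall i m, m < a -> v i m = 0.
Definition unitvec (a : int) (j : 'I_n) : kvec := fun i m => if (i == j) && (m == a) then 1 else 0.
Definition tchain (N : nat) : vset := tlat N%:Z.
Local Notation cspace := (@cspace k kvec tchain).

Lemma tlat_subsp a : subsp (tlat a).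
Proof.
split=> [//|x v w hv hw i m hm].
by rewrite [LHS](_ : _ = x * v i m + w i m) // hv // hw // mulr0 addr0.
Qed.
Lemma tlat_anti a a' : a <= a' -> subs (tlat a') (tlat a).
Proof. by move=> le v hv i m hm; apply/hv/(lt_le_trans hm). Qed.
Lemma lincomb_at d (c : 'I_d -> k) (b : 'I_d -> kvec) i m : lincomb c b i m = \sum_j c j * b j i m.
Proof. by rewrite /lincomb !fct_sumE. Qed.
Lemma lincomb_unitvec a c i m : lincomb c (unitvec a) i m = if m == a then c i else 0.
Proof.
rewrite lincomb_at (bigD1 i) //= big1 ?addr0 => [|j].
  by rewrite /unitvec eqxx; case: eqP; rewrite ?mulr1 ?mulr0.
by rewrite /unitvec eq_sym => /negPf ->; rewrite mulr0.
Qed.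
Lemma tlat_basis a : isbasis (tlat a) (tlat (a + 1)) (unitvec a).
Proof.
split.
- by move=> j i m hm; rewrite /unitvec (lt_eqF hm) andbF.
- move=> v hv; exists (fun i => v i a) => i m hm.
  transitivity (v i m - (if m == a then v i a else 0)).
    by rewrite -(lincomb_unitvec a (fun i => v i a) i m).
  case: eqP => [->|ne]; first by rewrite subrr.
  rewrite hv ?subrr //; lia.
- by move=> c h j; have := h j a; rewrite lincomb_unitvec eqxx => -> //; lia.
Qed.

Lemma tchain_subsp : forall N, subsp (tchain N). Proof. by move=> N; apply: tlat_subsp. Qed.
Lemma tchain_dec N : subs (tchain N.+1) (tchain N). Proof. by apply: tlat_anti; lia. Qed.
Lemma tchain_basis N : isbasis (tchain N) (tchain N.+1) (unitvec N%:Z).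
Proof. by rewrite /tchain (_ : N.+1%:Z = N%:Z + 1); [exact: tlat_basis|lia]. Qed.

Lemma findim_self L : findim (U := kvec) L L.
Proof.
exists 0%N, (fun _ => 0); split => [[]//|v hv|c _ []//].
exists (fun _ => 0); rewrite /lincomb big_ord0 subr0; exact: hv.
Qed.
Lemma tlat_findim a (m : nat) : findim (U := kvec) (tlat a) (tlat (a + m%:Z)).
Proof.
elim: m => [|m IH]; first by rewrite addr0; apply: findim_self.
apply: (findim_trans (tlat_subsp (a + m%:Z)) _ _ IH); [apply: tlat_anti; lia|apply: tlat_anti; lia|].
exists n, (unitvec (a + m%:Z)); rewrite (_ : a + m.+1%:Z = a + m%:Z + 1); [exact: tlat_basis|lia].
Qed.

(* The [k]-subspaces commensurable with [L0]: unlike [k[[t]]]-lattices, these are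
   visibly stable under intersection and semilinear images. *)
Definition klattice L := subsp L /\ exists a b, subs (tlat a) L /\ subs L (tlat b).

Lemma klattice_cspace L : klattice L -> cspace L.
Proof.
move=> [hL [a [b [ha hb]]]]; split=> //.
pose N := (absz a + absz b)%N; exists N.
have hN : subs (tchain N) L by move=> v hv; apply: ha; apply: tlat_anti hv; lia.
split => //; apply: findim_sub (tlat_findim b (absz (N%:Z - b)%R)) hb _ hN => //.
- exact: tlat_subsp.
- exact: tchain_subsp.
- by apply: tlat_anti; lia.
Qed.

Lemma klattice_vec L : klattice L -> subs L (@is_vec k 'I_n).
Proof. by move=> [_ [a [b [_ hb]]]] v /hb h i; exists b => m; apply: h. Qed.

Lemma klattice_subsp L : klattice L -> subsp L. Proof. by case. Qed.

Lemma klattice_cap L L' : klattice L -> klattice L' -> klattice (capL L L').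
Proof.
move=> [hL [a [b [ha hb]]]] [hL' [a' [b' [ha' hb']]]]; split; last first.
  exists (Order.max a a'), b; split; last by move=> v [/hb].
  move=> v hv; split; [apply: ha|apply: ha']; apply: tlat_anti hv; lia.
split; first by split; apply: subsp0.
by move=> x v w [? ?] [? ?]; split; [apply: (proj2 hL)|apply: (proj2 hL')].
Qed.

Lemma klattice_fd L M : klattice L -> klattice M -> subs M L ->
  exists d (b : 'I_d -> kvec), isbasis L M b.
Proof.
by move=> sL sM; apply: (cspace_findim tchain_subsp tchain_dec tchain_basis); apply: klattice_cspace.
Qed.

Definition vol L M d (h : 'I_d -> kvec) : k := @theta k kvec tchain n (fun N => unitvec N%:Z) L M d h.

Lemma vol_n0 L M d (h : 'I_d -> kvec) : klattice L -> klattice M -> subs M L -> isbasis L M h ->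
  vol L M h != 0.
Proof.
by move=> sL sM sub; apply: (theta_n0 tchain_subsp tchain_dec tchain_basis) => //; apply: klattice_cspace.
Qed.
Lemma vol_change L M d (h : 'I_d -> kvec) e (g : 'I_e -> kvec) P :
  klattice L -> klattice M -> subs M L -> isbasis L M h -> isbasis L M g -> ltrans M g h P ->
  vol L M g = vol L M h * sdet P.
Proof.
move=> sL sM sub hh hg hP; rewrite -(reldetP (klattice_subsp sM) hh hP).
by apply: (theta_change tchain_subsp tchain_dec tchain_basis) => //; apply: klattice_cspace.
Qed.
Lemma vol_cat L M M' d (h : 'I_d -> kvec) e (u : 'I_e -> kvec) :
  klattice L -> klattice M -> klattice M' -> subs M L -> subs M' M -> isbasis L M h -> isbasis M M' u ->
  vol L M' (lcat h u) = vol L M h * vol M M' u.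
Proof.
move=> sL sM sM' ? ? ? ?.
by apply: (theta_cat tchain_subsp tchain_dec tchain_basis) => //; apply: klattice_cspace.
Qed.

Lemma sdet_n0 L M d (h : 'I_d -> kvec) e (g : 'I_e -> kvec) P :
  klattice L -> klattice M -> subs M L -> isbasis L M h -> isbasis L M g -> ltrans M g h P ->
  sdet P != 0.
Proof.
move=> sL sM sub hh hg hP; apply/eqP => e0; have := vol_n0 sL sM sub hg.
by rewrite (vol_change sL sM sub hh hg hP) e0 mulr0 eqxx.
Qed.

Lemma cap_l L L' : subs (capL L L') L. Proof. by move=> v []. Qed.
Lemma cap_r L L' : subs (capL L L') L'. Proof. by move=> v []. Qed.

(** If [w] has coefficient [c] on the bases [b'], [b], then [c vol(b') / vol(b)] is independent of
    these bases: the change rule in [is_detvec] is inverse to that of [vol]. *)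
Definition dcoord L L' w : k := epsilon (inhabits 0) (fun c => forall d' b' d b,
  isbasis L' (capL L L') b' -> isbasis L (capL L L') b ->
  c = w d' b' d b * vol L' (capL L L') b' / vol L (capL L L') b).

Lemma dcoordE L L' w d' (b' : 'I_d' -> kvec) d (b : 'I_d -> kvec) :
  klattice L -> klattice L' -> is_detvec L L' w ->
  isbasis L' (capL L L') b' -> isbasis L (capL L L') b ->
  dcoord L L' w = w d' b' d b * vol L' (capL L L') b' / vol L (capL L L') b.
Proof.
move=> sL sL' [w0 w1] hb' hb.
pose P c := forall d' b' d b, isbasis L' (capL L L') b' -> isbasis L (capL L L') b ->
  c = w d' b' d b * vol L' (capL L L') b' / vol L (capL L L') b.
suff : exists c, P c by move=> h; apply: (epsilon_spec (inhabits 0) P h).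
have sI := klattice_cap sL sL'.
exists (w d' b' d b * vol L' (capL L L') b' / vol L (capL L L') b).
move=> e' g' e g hg' hg.
have [Q' hQ'] := trans_ex hb' (let: And3 x _ _ := hg' in x).
have [Q hQ] := trans_ex hb (let: And3 x _ _ := hg in x).
have l' := @cap_r L L'; have l := @cap_l L L'.
rewrite (vol_change sL sI l hb hg hQ) (vol_change sL' sI l' hb' hg' hQ').
rewrite (w1 d' b' e' g' d b e g Q' Q (proj2 (basis_modE _ _ _) hb')
  (proj2 (basis_modE _ _ _) hg') (proj2 (basis_modE _ _ _) hb) (proj2 (basis_modE _ _ _) hg)
  (proj2 (transE _ _ _ _) hQ') (proj2 (transE _ _ _ _) hQ)).
have := sdet_n0 sL sI l hb hg hQ; have := sdet_n0 sL' sI l' hb' hg' hQ'.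
have := vol_n0 sL sI l hb.
by move=> ? ? ?; field; apply/and3P.
Qed.

Lemma cap_bases L L' : klattice L -> klattice L' -> exists d' (b' : 'I_d' -> kvec) d (b : 'I_d -> kvec),
  isbasis L' (capL L L') b' /\ isbasis L (capL L L') b.
Proof.
move=> sL sL'; have sI := klattice_cap sL sL'.
have [d' [b' hb']] := klattice_fd sL' sI (@cap_r L L').
have [d [b hb]] := klattice_fd sL sI (@cap_l L L').
by exists d', b', d, b.
Qed.

Lemma dcoord_n0 L L' w : klattice L -> klattice L' -> is_detvec L L' w -> dcoord L L' w != 0.
Proof.
move=> sL sL' hw; have [d' [b' [d [b [hb' hb]]]]] := cap_bases sL sL'.
have sI := klattice_cap sL sL'.
rewrite (dcoordE sL sL' hw hb' hb).
rewrite !mulf_neq0 ?invr_eq0 ?(vol_n0 _ sI (@cap_l L L')) ?(vol_n0 _ sI (@cap_r L L')) //.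
by case: hw => h _; apply: h; apply/basis_modE.
Qed.

Lemma dcoord_ex L L' c : klattice L -> klattice L' -> c != 0 -> exists w, is_detvec L L' w /\ dcoord L L' w = c.
Proof.
move=> sL sL' c0; have sI := klattice_cap sL sL'.
have l' := @cap_r L L'; have l := @cap_l L L'.
pose w : detfun := fun d' b' d b => c * vol L (capL L L') b / vol L' (capL L L') b'.
have hw : is_detvec L L' w.
  split.
    move=> d' b' d b /basis_modE hb' /basis_modE hb.
    by rewrite /w !mulf_neq0 ?invr_eq0 ?(vol_n0 _ sI l) ?(vol_n0 _ sI l').
  move=> d' b' e' g' d b e g P' P /basis_modE hb' /basis_modE hg' /basis_modE hb
    /basis_modE hg /transE hP' /transE hP; rewrite /w.
  rewrite (vol_change sL sI l hb hg hP) (vol_change sL' sI l' hb' hg' hP').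
  have := sdet_n0 sL' sI l' hb' hg' hP'; have := vol_n0 sL' sI l' hb'.
  by move=> ? ?; field; apply/andP.
exists w; split => //.
have [d' [b' [d [b [hb' hb]]]]] := cap_bases sL sL'.
rewrite (dcoordE sL sL' hw hb' hb) /w.
have := vol_n0 sL sI l hb; have := vol_n0 sL' sI l' hb'.
by move=> ? ?; field; apply/andP.
Qed.

Lemma scale_detvec L L' w c : c != 0 -> is_detvec L L' w ->
  is_detvec L L' (fun d' b' d b => c * w d' b' d b).
Proof.
move=> c0 [w0 w1]; split.
  by move=> *; rewrite mulf_neq0 //; apply: w0.
move=> d' b' e' g' d b e g P' P h1 h2 h3 h4 h5 h6.
by rewrite (w1 _ _ _ _ _ _ _ _ _ _ h1 h2 h3 h4 h5 h6) !mulrA.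
Qed.
Lemma dcoord_scale L L' w c : klattice L -> klattice L' -> c != 0 -> is_detvec L L' w ->
  dcoord L L' (fun d' b' d b => c * w d' b' d b) = c * dcoord L L' w.
Proof.
move=> sL sL' c0 hw; have [d' [b' [d [b [hb' hb]]]]] := cap_bases sL sL'.
by rewrite (dcoordE sL sL' hw hb' hb) (dcoordE sL sL' (scale_detvec c0 hw) hb' hb) !mulrA.
Qed.

(** Appending a basis [u] of [capL L L'] modulo [M] multiplies the volumes in [L] and in [L'] by the
    same [vol (capL L L') M u], which cancels in the ratio. *)
Lemma coefM_dcoord L L' w M e' (g' : 'I_e' -> kvec) e (g : 'I_e -> kvec) c :
  klattice L -> klattice L' -> klattice M -> subs M (capL L L') -> is_detvec L L' w ->
  isbasis L' M g' -> isbasis L M g ->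
  Defs.coefM L L' w M g' g c <-> c = dcoord L L' w * vol L M g / vol L' M g'.
Proof.
move=> sL sL' sM sub hw hg' hg.
have sI := klattice_cap sL sL'.
have l' := @cap_r L L'; have l := @cap_l L L'.
have key d' (b' : 'I_d' -> kvec) d (b : 'I_d -> kvec) m (u : 'I_m -> kvec) P' P :
  isbasis L' (capL L L') b' -> isbasis L (capL L L') b -> isbasis (capL L L') M u ->
  ltrans M g' (lcat b' u) P' -> ltrans M g (lcat b u) P ->
  w d' b' d b * sdet P / sdet P' = dcoord L L' w * vol L M g / vol L' M g'.
  move=> hb' hb hu hP' hP.
  rewrite (dcoordE sL sL' hw hb' hb).
  have c' := basis_cat (klattice_subsp sI) l' sub hb' hu.
  have cc := basis_cat (klattice_subsp sI) l sub hb hu.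
  have ML v : M v -> L v by move/sub/l.
  have ML' v : M v -> L' v by move/sub/l'.
  rewrite (vol_change sL sM ML cc hg hP) (vol_change sL' sM ML' c' hg' hP').
  rewrite (vol_cat sL sI sM) // (vol_cat sL' sI sM) //.
  have := sdet_n0 sL' sM ML' c' hg' hP'; have := vol_n0 sL' sI l' hb'.
  have := vol_n0 sL sI l hb; have := vol_n0 sI sM sub hu.
  by move=> ? ? ? ?; field; apply/and4P.
split.
  move=> [d' [b' [d [b [m [u [P' [P [/basis_modE h1 /basis_modE h2 /basis_modE h3]]]]]]]]].
  by move=> [/transE h4 /transE h5] ->; apply: key h4 h5.
move=> ->.
have [d' [b' [d [b [hb' hb]]]]] := cap_bases sL sL'.
have [m [u hu]] := klattice_fd sI sM sub.
have c' := basis_cat (klattice_subsp sI) l' sub hb' hu.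
have cc := basis_cat (klattice_subsp sI) l sub hb hu.
have [P' hP'] := trans_ex c' (let: And3 x _ _ := hg' in x).
have [P hP] := trans_ex cc (let: And3 x _ _ := hg in x).
exists d', b', d, b, m, u, P', P; split; try by apply/basis_modE.
  by split; apply/transE.
by rewrite -(key _ _ _ _ _ _ _ _ hb' hb hu hP' hP).
Qed.

Lemma wedge_dcoord L L' L'' w1 w2 w3 : klattice L -> klattice L' -> klattice L'' ->
  is_detvec L L' w1 -> is_detvec L' L'' w2 -> is_detvec L L'' w3 ->
  wedge_rel L L' L'' w1 w2 w3 <-> dcoord L L'' w3 = dcoord L L' w1 * dcoord L' L'' w2.
Proof.
move=> s s' s'' h1 h2 h3.
pose M := capL (capL L L') L''.
have sM : klattice M by apply: klattice_cap => //; apply: klattice_cap.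
have M1 : subs M (capL L L') by move=> v [].
have M2 : subs M (capL L' L'') by move=> v [[]].
have M3 : subs M (capL L L'') by move=> v [[]].
have ML : subs M L by move=> v [[]].
have ML' : subs M L' by move=> v [[]].
have ML'' : subs M L'' by move=> v [].
split; last first.
  move=> e; rewrite /wedge_rel /= -/M => d g d' g' d'' g'' c1 c2 /basis_modE hg /basis_modE hg' /basis_modE hg''.
  move=> /(coefM_dcoord _ s s' sM M1 h1 hg' hg) -> /(coefM_dcoord _ s' s'' sM M2 h2 hg'' hg') ->.
  apply/(coefM_dcoord _ s s'' sM M3 h3 hg'' hg); rewrite e.
  have := vol_n0 s' sM ML' hg'; have := vol_n0 s'' sM ML'' hg''.
  by move=> ? ?; field; apply/andP.
(* [wedge_rel] is an implication over all bases, so it yields the equation only once bases and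
   transported coefficients have been produced. *)
move=> hr.
have [d [g hg]] := klattice_fd s sM ML.
have [d' [g' hg']] := klattice_fd s' sM ML'.
have [d'' [g'' hg'']] := klattice_fd s'' sM ML''.
have e1 := (coefM_dcoord _ s s' sM M1 h1 hg' hg).2 erefl.
have e2 := (coefM_dcoord _ s' s'' sM M2 h2 hg'' hg').2 erefl.
have := hr _ _ _ _ _ _ _ _ (proj2 (basis_modE _ _ _) hg) (proj2 (basis_modE _ _ _) hg')
  (proj2 (basis_modE _ _ _) hg'') e1 e2.
move=> /(coefM_dcoord _ s s'' sM M3 h3 hg'' hg) E.
have n0 := vol_n0 s sM ML hg.
have n0' := vol_n0 s' sM ML' hg'.
have n0'' := vol_n0 s'' sM ML'' hg''.
apply: (mulIf n0); apply: (mulIf (invr_neq0 n0'')); rewrite -E.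
by field; apply/andP.
Qed.

(** * Bounded automorphisms and their factors on determinant lines *)

Local Notation V := (@is_vec k 'I_n).

Lemma V_subsp : subsp V.
Proof.
split; first by move=> i; apply: laurent0.
move=> a v w hv hw i.
exact: (laurentD (laurentZ a (hv i)) (hw i)).
Qed.

(** The uniform shift [C] is the continuity that makes images of [k]-lattices [k]-lattices.
    Linearity is over [k] only, so that matrices, [sigma_q] and their composites are treated
    alike. *)
Definition bounded_lin phi := [/\ linon V phi, forall v, V v -> V (phi v)
  & exists C : int, forall a v, tlat a v -> tlat (a - C) (phi v)].
Definition bauto phi psi := [/\ bounded_lin phi, bounded_lin psi, forall v, V v -> psi (phi v) = v
  & forall v, V v -> phi (psi v) = v].

Lemma bauto_sym phi psi : bauto phi psi -> bauto psi phi.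
Proof. by case. Qed.
Lemma bauto_lin phi psi : bauto phi psi -> linon V phi. Proof. by case=> [[]]. Qed.
Lemma bauto_inj phi psi : bauto phi psi -> injon (U := kvec) V phi.
Proof. by move=> [_ _ h _] v w hv hw e; rewrite -(h v) // e h. Qed.

Lemma bauto_comp phi psi phi' psi' : bauto phi psi -> bauto phi' psi' ->
  bauto (phi \o phi') (psi' \o psi).
Proof.
move=> [[l1 v1 [C1 b1]] [l2 v2 [C2 b2]] c1 c2] [[l3 v3 [C3 b3]] [l4 v4 [C4 b4]] c3 c4].
split.
- split => [a v w hv hw|v hv|] /=; [by rewrite l3 // l1 //; apply: v3|by apply/v1/v3|].
  exists (C3 + C1) => a v /b3 /b1; rewrite opprD addrA; exact.
- split => [a v w hv hw|v hv|] /=; [by rewrite l2 // l4 //; apply: v2|by apply/v4/v2|].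
  exists (C2 + C4) => a v /b2 /b4; rewrite opprD addrA; exact.
- by move=> v hv /=; rewrite c1 ?c3 //; apply: v3.
- by move=> v hv /=; rewrite c4 ?c2 //; apply: v2.
Qed.

Lemma img_klattice phi psi L : bauto phi psi -> klattice L -> klattice (img phi L).
Proof.
move=> h sL; have hV := V_subsp; split.
  by apply: (img_subsp hV (bauto_lin h)) => //; [exact: klattice_subsp|exact: klattice_vec].
case: h => [[l1 v1 [C1 b1]] [l2 v2 [C2 b2]] c1 c2].
case: sL => [_ [a [b [ha hb]]]]; exists (a + C2), (b - C1); split.
  move=> v hv; exists (psi v); split; last by rewrite c2 // => i; exists (a + C2) => m; apply: hv.
  by apply: ha; have := b2 _ _ hv; rewrite addrK.
by move=> _ [v [/hb hv ->]]; apply: b1.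
Qed.

Lemma img_cap phi psi L L' : bauto phi psi -> subs L V -> subs L' V ->
  img phi (capL L L') = capL (img phi L) (img phi L').
Proof.
move=> h sL sL'; apply/funext => w; apply/propext; split.
  by move=> [v [[? ?] ->]]; split; exists v.
move=> [[v [hv ->]] [v' [hv' /(bauto_inj h) e]]]; exists v; split => //; split=> //.
rewrite e //; [exact: sL|exact: sL'].
Qed.

Lemma img_comp phi phi' L : img (phi \o phi') L = img phi (img phi' L).
Proof.
apply/funext => w; apply/propext; split.
  by move=> [v [hv ->]]; exists (phi' v); split => //; exists v.
by move=> [_ [[v [hv ->]] ->]]; exists v.
Qed.
Lemma img_ext phi phi' L : subs L V -> (forall v, V v -> phi v = phi' v) ->
  img phi L = img phi' L.
Proof.
move=> sL h; apply/funext => w; apply/propext.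
by split => -[v [hv ->]]; exists v; rewrite h //; apply: sL.
Qed.
Lemma img_idV phi L : subs L V -> (forall v, V v -> phi v = v) -> img phi L = L.
Proof.
move=> sL h; apply/funext => w; apply/propext.
by split => [[v [hv ->]]|hw]; [rewrite h //; apply: sL|exists w; rewrite h //; apply: sL].
Qed.

(* The determinant of [phi : L/M -> phi L/phi M] with respect to [vol]. *)
Definition rho phi L M : k := epsilon (inhabits 0) (fun c => forall d (h : 'I_d -> kvec),
  isbasis L M h -> c = vol (img phi L) (img phi M) (phi \o h) / vol L M h).

Lemma basis_vec L M d (h : 'I_d -> kvec) : klattice L -> isbasis L M h -> forall i, V (h i).
Proof. by move=> sL [h1 _ _] i; apply: (klattice_vec sL). Qed.

Lemma img_basis phi psi L M d (h : 'I_d -> kvec) : bauto phi psi -> klattice L -> klattice M ->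
  isbasis L M h -> isbasis (img phi L) (img phi M) (phi \o h).
Proof.
move=> hp sL sM; apply: (basis_img V_subsp (bauto_lin hp) (bauto_inj hp)); exact: klattice_vec.
Qed.

(** [phi] preserves the transition matrix between two bases, so numerator and denominator change by
    the same determinant. *)
Lemma rhoE phi psi L M d (h : 'I_d -> kvec) : bauto phi psi -> klattice L -> klattice M -> subs M L ->
  isbasis L M h -> rho phi L M = vol (img phi L) (img phi M) (phi \o h) / vol L M h.
Proof.
move=> hp sL sM sub hh.
pose P c := forall d (h : 'I_d -> kvec),
  isbasis L M h -> c = vol (img phi L) (img phi M) (phi \o h) / vol L M h.
suff : exists c, P c by move=> hc; apply: (epsilon_spec (inhabits 0) P hc).
exists (vol (img phi L) (img phi M) (phi \o h) / vol L M h) => e g hg.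
have [Q hQ] := trans_ex hh (let: And3 x _ _ := hg in x).
have sL' := img_klattice hp sL; have sM' := img_klattice hp sM.
have sub' : subs (img phi M) (img phi L) := img_subs sub.
rewrite (vol_change sL sM sub hh hg hQ).
rewrite (vol_change sL' sM' sub' (img_basis hp sL sM hh) (img_basis hp sL sM hg) (P := Q)).
  have := vol_n0 sL sM sub hh; have := sdet_n0 sL sM sub hh hg hQ.
  by move=> ? ?; field; apply/andP.
exact: (trans_img V_subsp (bauto_lin hp) (basis_vec sL hg) (basis_vec sL hh) hQ).
Qed.

Lemma rho_n0 phi psi L M : bauto phi psi -> klattice L -> klattice M -> subs M L -> rho phi L M != 0.
Proof.
move=> hp sL sM sub; have [d [h hh]] := klattice_fd sL sM sub.
rewrite (rhoE hp sL sM sub hh) mulf_neq0 ?invr_eq0 ?(vol_n0 sL sM) //.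
by apply: vol_n0; [exact: img_klattice hp _|exact: img_klattice hp _|exact: img_subs|exact: img_basis hp _ _ _].
Qed.

Lemma rho_mul phi psi L M M' : bauto phi psi -> klattice L -> klattice M -> klattice M' ->
  subs M L -> subs M' M -> rho phi L M' = rho phi L M * rho phi M M'.
Proof.
move=> hp sL sM sM' s1 s2.
have [d [h hh]] := klattice_fd sL sM s1; have [m [u hu]] := klattice_fd sM sM' s2.
have s12 : subs M' L by move=> v /s2/s1.
have hc := basis_cat (klattice_subsp sM) s1 s2 hh hu.
rewrite (rhoE hp sL sM s1 hh) (rhoE hp sM sM' s2 hu) (rhoE hp sL sM' s12 hc).
have -> : phi \o lcat h u = lcat (phi \o h) (phi \o u).
  by apply/funext => i; rewrite /lcat /=; case: fintype.split.
rewrite (vol_cat sL sM sM') // (vol_cat (img_klattice hp sL) (img_klattice hp sM) (img_klattice hp sM')).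
- have := vol_n0 sL sM s1 hh; have := vol_n0 sM sM' s2 hu.
  by move=> ? ?; field; apply/andP.
- exact: img_subs.
- exact: img_subs.
- exact: img_basis hp _ _ _.
- exact: img_basis hp _ _ _.
Qed.

(** The number by which [phi] multiplies coordinates on [det(L,L')], see [dcoord_transport]; [L]
    enters through a dual, hence in the denominator. *)
Definition dfactor phi L L' : k := rho phi L' (capL L L') / rho phi L (capL L L').

(** The contribution of [capL L L'] over [M] occurs twice and cancels. Several lattices can thus be
    compared over one common [M]. *)
Lemma dfactorE phi psi L L' M : bauto phi psi -> klattice L -> klattice L' -> klattice M ->
  subs M L -> subs M L' -> dfactor phi L L' = rho phi L' M / rho phi L M.
Proof.
move=> hp sL sL' sM s s'.
have sI := klattice_cap sL sL'; have l' := @cap_r L L'; have l := @cap_l L L'.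
have sub : subs M (capL L L') by move=> v hv; split; [apply: s|apply: s'].
rewrite (rho_mul hp sL sI sM) // (rho_mul hp sL' sI sM) // /dfactor.
have := rho_n0 hp sI sM sub; have := rho_n0 hp sL sI l.
by move=> ? ?; field; apply/andP.
Qed.

Lemma dfactor_n0 phi psi L L' : bauto phi psi -> klattice L -> klattice L' -> dfactor phi L L' != 0.
Proof.
move=> hp sL sL'; have sI := klattice_cap sL sL'.
by rewrite /dfactor mulf_neq0 ?invr_eq0 ?(rho_n0 hp) //; [apply: cap_r|apply: cap_l].
Qed.

Lemma dfactor_add phi psi L L' L'' : bauto phi psi -> klattice L -> klattice L' -> klattice L'' ->
  dfactor phi L L' * dfactor phi L' L'' = dfactor phi L L''.
Proof.
move=> hp s s' s''.
pose M := capL (capL L L') L''.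
have sM : klattice M by apply: klattice_cap => //; apply: klattice_cap.
have ML : subs M L by move=> v [[]].
have ML' : subs M L' by move=> v [[]].
have ML'' : subs M L'' by move=> v [].
rewrite (dfactorE hp s s' sM) // (dfactorE hp s' s'' sM) // (dfactorE hp s s'' sM) //.
have := rho_n0 hp s sM ML; have := rho_n0 hp s' sM ML'.
by move=> ? ?; field; apply/andP.
Qed.

(** Additivity makes this factor idempotent, and it is nonzero. *)
Lemma dfactor_refl phi psi L : bauto phi psi -> klattice L -> dfactor phi L L = 1.
Proof.
move=> hp sL; apply: (mulfI (dfactor_n0 hp sL sL)).
by rewrite (dfactor_add hp sL sL sL) mulr1.
Qed.

Lemma dcoord_transport phi psi L L' w w2 : bauto phi psi -> klattice L -> klattice L' ->
  is_detvec L L' w -> is_detvec (img phi L) (img phi L') w2 -> transport_rel phi L L' w w2 ->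
  dcoord (img phi L) (img phi L') w2 = dfactor phi L L' * dcoord L L' w.
Proof.
move=> hp sL sL' hw hw2 ht.
have sI := klattice_cap sL sL'; have l' := @cap_r L L'; have l := @cap_l L L'.
have [d' [b' [d [b [hb' hb]]]]] := cap_bases sL sL'.
have eI := img_cap hp (klattice_vec sL) (klattice_vec sL').
have hb1 := img_basis hp sL sI hb; have hb1' := img_basis hp sL' sI hb'.
rewrite /dfactor (rhoE hp sL sI l hb) (rhoE hp sL' sI l' hb') (dcoordE sL sL' hw hb' hb).
rewrite eI in hb1 hb1' *.
rewrite (dcoordE (img_klattice hp sL) (img_klattice hp sL') hw2 hb1' hb1).
rewrite ht; [|by apply/basis_modE..].
have := vol_n0 sL sI l hb; have := vol_n0 sL' sI l' hb'.
have := vol_n0 (img_klattice hp sL) (klattice_cap (img_klattice hp sL) (img_klattice hp sL')) (@cap_l _ _) hb1.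
by move=> ? ? ?; field; apply/and3P.
Qed.

Lemma img_can phi psi L : bauto phi psi -> subs L V -> img psi (img phi L) = L.
Proof.
by move=> [_ _ c1 c2] sL; rewrite -img_comp; apply: img_idV.
Qed.

Lemma transport_ex phi psi L L' w : bauto phi psi -> klattice L -> klattice L' -> is_detvec L L' w ->
  exists w2, is_detvec (img phi L) (img phi L') w2 /\ transport_rel phi L L' w w2.
Proof.
move=> hp sL sL' [h0 h1].
(* Coefficients on bases of the images are read off after pulling these bases back by [psi]. *)
exists (fun d' b' d b => w d' (psi \o b') d (psi \o b)).
have hs := bauto_sym hp.
have sK := img_klattice hp sL; have sK' := img_klattice hp sL'.
have sI := klattice_cap sK sK'.
have vI := klattice_vec sI.
have eI : img psi (capL (img phi L) (img phi L')) = capL L L'.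
  by rewrite (img_cap hs (klattice_vec sK) (klattice_vec sK')) !(img_can hp) //; apply: klattice_vec.
have back K d (b : 'I_d -> kvec) : klattice K -> basis_mod (img phi K) (capL (img phi L) (img phi L')) b ->
    basis_mod K (capL L L') (psi \o b).
  move=> s /basis_modE hb; apply/basis_modE; rewrite -eI -(img_can hp (klattice_vec s)).
  by apply: (img_basis hs) => //; apply: img_klattice hp s.
have backt K d (b : 'I_d -> kvec) e (g : 'I_e -> kvec) P : klattice K ->
   basis_mod (img phi K) (capL (img phi L) (img phi L')) b ->
   basis_mod (img phi K) (capL (img phi L) (img phi L')) g ->
   trans (capL (img phi L) (img phi L')) g b P -> trans (capL L L') (psi \o g) (psi \o b) P.
  move=> s /basis_modE hb /basis_modE hg /transE hP; apply/transE; rewrite -eI.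
  exact: (trans_img V_subsp (bauto_lin hs) (basis_vec (img_klattice hp s) hg)
    (basis_vec (img_klattice hp s) hb) hP).
split.
  split; first by move=> d' b' d b hb' hb; apply: h0; apply: back.
  move=> d' b' e' g' d b e g P' P hb' hg' hb hg hP' hP.
  by apply: h1; do ?[exact: back | exact: (backt L') | exact: (backt L)].
move=> d' b' d b /basis_modE hb' /basis_modE hb.
have can K e (c : 'I_e -> kvec) : klattice K -> isbasis K (capL L L') c -> psi \o (phi \o c) = c.
  move=> s hc; apply/funext => i /=; case: hp => _ _ -> //; exact: (basis_vec s hc).
suff -> : w d' b' d b = w d' (psi \o (phi \o b')) d (psi \o (phi \o b)) by [].
by rewrite (can _ _ _ sL' hb') (can _ _ _ sL hb).
Qed.

Lemma rho_ext phi psi phi' psi' L M : bauto phi psi -> bauto phi' psi' ->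
  (forall v, V v -> phi v = phi' v) ->
  klattice L -> klattice M -> subs M L -> rho phi L M = rho phi' L M.
Proof.
move=> hp hp' e sL sM sub; have [d [h hh]] := klattice_fd sL sM sub.
rewrite (rhoE hp sL sM sub hh) (rhoE hp' sL sM sub hh).
rewrite (img_ext (klattice_vec sL) e) (img_ext (klattice_vec sM) e).
suff -> : phi \o h = phi' \o h by [].
apply/funext => i /=; apply: e; exact: (basis_vec sL hh).
Qed.
Lemma dfactor_ext phi psi phi' psi' L L' : bauto phi psi -> bauto phi' psi' ->
  (forall v, V v -> phi v = phi' v) -> klattice L -> klattice L' -> dfactor phi L L' = dfactor phi' L L'.
Proof.
move=> hp hp' e sL sL'; have sI := klattice_cap sL sL'.
have l' := @cap_r L L'; have l := @cap_l L L'.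
by rewrite /dfactor !(rho_ext hp hp').
Qed.

Lemma rho_comp phi psi phi' psi' L M : bauto phi psi -> bauto phi' psi' ->
  klattice L -> klattice M -> subs M L ->
  rho (phi \o phi') L M = rho phi (img phi' L) (img phi' M) * rho phi' L M.
Proof.
move=> hp hp' sL sM sub; have [d [h hh]] := klattice_fd sL sM sub.
have hh' := img_basis hp' sL sM hh.
have sL' := img_klattice hp' sL; have sM' := img_klattice hp' sM.
have sub' : subs (img phi' M) (img phi' L) := img_subs sub.
rewrite (rhoE hp' sL sM sub hh) (rhoE hp sL' sM' sub' hh').
rewrite (rhoE (bauto_comp hp hp') sL sM sub hh).
rewrite (img_comp phi phi' L) (img_comp phi phi' M).
have := vol_n0 sL' sM' sub' hh'; have := vol_n0 sL sM sub hh.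
by move=> ? ?; field; apply/andP.
Qed.
Lemma dfactor_comp phi psi phi' psi' L L' : bauto phi psi -> bauto phi' psi' ->
  klattice L -> klattice L' ->
  dfactor (phi \o phi') L L' = dfactor phi (img phi' L) (img phi' L') * dfactor phi' L L'.
Proof.
move=> hp hp' sL sL'; have sI := klattice_cap sL sL'.
have l' := @cap_r L L'; have l := @cap_l L L'.
rewrite /dfactor !(rho_comp hp hp') // (img_cap hp' (klattice_vec sL) (klattice_vec sL')).
have sK := img_klattice hp' sL; have sK' := img_klattice hp' sL'.
have := rho_n0 hp sK (klattice_cap sK sK') (@cap_l _ _); have := rho_n0 hp' sL sI l.
by move=> ? ?; field; apply/andP.
Qed.

Lemma rho_id phi psi L M : bauto phi psi -> (forall v, V v -> phi v = v) ->
  klattice L -> klattice M -> subs M L -> rho phi L M = 1.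
Proof.
move=> hp e sL sM sub; have [d [h hh]] := klattice_fd sL sM sub.
rewrite (rhoE hp sL sM sub hh) !img_idV //; try exact: klattice_vec.
have -> : phi \o h = h by apply/funext => i /=; apply: e; exact: (basis_vec sL hh).
by rewrite divff // vol_n0.
Qed.
Lemma dfactor_id phi psi L L' : bauto phi psi -> (forall v, V v -> phi v = v) ->
  klattice L -> klattice L' -> dfactor phi L L' = 1.
Proof.
move=> hp e sL sL'; have sI := klattice_cap sL sL'.
have l' := @cap_r L L'; have l := @cap_l L L'.
by rewrite /dfactor !(rho_id hp e) // divr1.
Qed.
End DetLine.

(** * The central extension and its twisted conjugacy *)

Section Cocycle.
Variables (k : fieldType) (n : nat).
Local Notation kvec := (@kvec k n).
Local Notation V := (@is_vec k 'I_n).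

(** Two double evaluations are combined: the composite [y' F2 = F3 y'] on the pair [(L, y L)], and
    [y'] along the two chains from [L] to [F2 y L], through [F2 L] and through [y L]. The relation
    [y F1 = F2 y] identifies [y F1 L] with [F2 y L]. *)
Lemma kappa_cocycle (y yi y' yi' F1 G1 F2 G2 F3 G3 : kvec -> kvec) (L : vset k n) :
  bauto y yi -> bauto y' yi' -> bauto F1 G1 -> bauto F2 G2 -> bauto F3 G3 -> klattice L ->
  (forall v, V v -> y (F1 v) = F2 (y v)) -> (forall v, V v -> y' (F2 v) = F3 (y' v)) ->
  dfactor y' L (img F2 L) / dfactor F3 L (img y' L) * (dfactor y L (img F1 L) / dfactor F2 L (img y L)) =
  dfactor (y' \o y) L (img F1 L) / dfactor F3 L (img (y' \o y) L).
Proof.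
move=> hy hy' h1 h2 h3 sL e1 e2.
have vL := klattice_vec sL.
have s1 := img_klattice h1 sL; have s2 := img_klattice h2 sL.
have sy := img_klattice hy sL; have sy' := img_klattice hy' sL.
have s2y := img_klattice h2 sy; have sy'y := img_klattice hy' sy.
have E1 : img y (img F1 L) = img F2 (img y L).
  by rewrite -!img_comp; apply: img_ext.
rewrite (dfactor_comp hy' hy sL s1) E1 (img_comp y' y L).
rewrite -(dfactor_add h3 sL sy' sy'y).
have E2 : dfactor (y' \o F2) L (img y L) = dfactor (F3 \o y') L (img y L).
  by apply: (dfactor_ext (bauto_comp hy' h2) (bauto_comp h3 hy')) => // v hv; apply: e2.
rewrite (dfactor_comp hy' h2 sL sy) (dfactor_comp h3 hy' sL sy) in E2.
have E3 := dfactor_add hy' sL sy s2y; rewrite -(dfactor_add hy' sL s2 s2y) in E3.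
have na := dfactor_n0 h3 sL sy'; have nb := dfactor_n0 h3 sy' sy'y.
have nd := dfactor_n0 h2 sL sy; have ne := dfactor_n0 hy' s2 s2y; have nf := dfactor_n0 hy' sL sy.
suff E : dfactor y' L (img F2 L) * dfactor F3 (img y' L) (img y' (img y L)) =
   dfactor y' (img y L) (img F2 (img y L)) * dfactor F2 L (img y L).
  apply: (mulIf nd); apply: (mulIf nb); apply: (mulIf na).
  transitivity ((dfactor y' L (img F2 L) * dfactor F3 (img y' L) (img y' (img y L))) * dfactor y L (img F1 L)).
    by field; apply/andP.
  by rewrite E; field; apply/andP.
apply: (mulIf ne); apply: (mulIf nf).
transitivity ((dfactor y' L (img F2 L) * dfactor y' (img F2 L) (img F2 (img y L))) *
  (dfactor F3 (img y' L) (img y' (img y L)) * dfactor y' L (img y L))); first by ring.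
by rewrite -E2 -E3; ring.
Qed.
End Cocycle.

(** * The extended group in coordinates, and the scalar [kappa] *)

Section TGL.
Variables (k : fieldType) (q : k) (q0 : q != 0) (n : nat).
Local Notation kvec := (@kvec k n).
Local Notation V := (@is_vec k 'I_n).
Local Notation mat := (mat k 'I_n 'I_n).
Local Notation I1 := (@mat1 k 'I_n).
Local Notation L0 := (@L0 k n).
Implicit Types (g Y : mat) (x y z : tgl k n).

Lemma mat_bound (A : mat) : is_mat A -> exists c : int, forall i j, supp (A i j) c.
Proof.
(* keeps [lia] from recording a dependency on [q0] *)
clear q0; move=> hA; exists (- (\sum_i \sum_j absz (lo (A i j)))%N%:Z) => i j.
apply: suppW (lo_supp (hA i j)).
have h1 : (absz (lo (A i j)) <= \sum_j absz (lo (A i j)))%N by rewrite (bigD1 j) ?leq_addr.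
have h2 : (\sum_j absz (lo (A i j)) <= \sum_i \sum_j absz (lo (A i j)))%N.
  by rewrite [X in (_ <= X)%N](bigD1 i) ?leq_addr.
lia.
Qed.

Lemma bounded_matvec (A : mat) : is_mat A -> bounded_lin (n := n) (matvec A).
Proof.
clear q0; move=> hA; split; first by move=> a v w hv hw; apply: matvec_lin.
  by move=> v; apply: is_vec_matvec.
have [c hc] := mat_bound hA; exists (- c) => a v hv i m hm.
rewrite /matvec /lsum big1 // => j _.
by apply: (supp_mul (hc i j) (b := a)); [move=> l; apply: hv | lia].
Qed.

Lemma bauto_mat (g h : mat) : is_mat g -> is_mat h -> matmul g h = I1 -> matmul h g = I1 ->
  bauto (n := n) (matvec g) (matvec h).
Proof.
move=> hg hh e1 e2; split; [exact: bounded_matvec..|move=> v hv|move=> v hv];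
by rewrite matvecA // ?e1 ?e2 matvec1.
Qed.

Lemma bounded_sig (r : k) : bounded_lin (n := n) (@vsig k r 'I_n).
Proof.
split; last by exists 0 => a v hv i m; rewrite subr0 => hm; rewrite /vsig /lsig hv ?mulr0.
  move=> a v w _ _; apply/funext => i; apply/funext => m.
  rewrite /vsig /lsig [RHS](_ : _ = a * (r ^ m * v i m) + r ^ m * w i m) //.
  by rewrite [LHS](_ : _ = r ^ m * (a * v i m + w i m)) //; ring.
exact: is_vec_sig.
Qed.

Lemma vsigK (v : vec k 'I_n) : vsig q^-1 (vsig q v) = v.
Proof.
apply/funext => i; apply/funext => m; rewrite /vsig /lsig mulrA -expfzMl mulVf //.
by rewrite exp1rz mul1r.
Qed.
Lemma vsigKV (v : vec k 'I_n) : vsig q (vsig q^-1 v) = v.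
Proof.
apply/funext => i; apply/funext => m; rewrite /vsig /lsig mulrA -expfzMl mulfV //.
by rewrite exp1rz mul1r.
Qed.

Lemma bauto_sig : bauto (n := n) (@vsig k q 'I_n) (@vsig k q^-1 'I_n).
Proof.
split; [exact: bounded_sig..|by move=> v _; apply: vsigK|by move=> v _; apply: vsigKV].
Qed.

Lemma L0_tlat : L0 = @tlat k n 0.
Proof.
apply/funext => v; apply/propext; split=> [[_ h]|h]; first exact: h.
split; last exact: h.
by move=> i; exists 0 => m; exact: h.
Qed.
Lemma tlat_klattice a : klattice (@tlat k n a).
Proof. by split; [exact: tlat_subsp|exists a, a; split => v]. Qed.
Lemma L0_klattice : klattice L0. Proof. by rewrite L0_tlat; apply: tlat_klattice. Qed.

Lemma img_vsig_L0 : img (U := kvec) (@vsig k q 'I_n) L0 = L0.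
Proof.
rewrite L0_tlat; apply/funext => v; apply/propext; split.
  by move=> [w [hw ->]] i m hm; rewrite /vsig /lsig hw // mulr0.
move=> hv; exists (vsig q^-1 v); rewrite vsigKV; split => // i m hm.
by rewrite /vsig /lsig hv // mulr0.
Qed.

Lemma GL_mat g : is_GL g -> is_mat g. Proof. by case. Qed.
Lemma GL1 : is_GL I1.
Proof. by have h := @is_mat1 k 'I_n; split => //; exists I1; rewrite !matmul1m. Qed.
Lemma GL_mul g h : is_GL g -> is_GL h -> is_GL (matmul g h).
Proof.
move=> [mg [gi [mgi [g1 g2]]]] [mh [hi [mhi [h1 h2]]]].
have mm := is_mat_mul; split; first exact: mm.
exists (matmul hi gi); split; first exact: mm.
split; rewrite matmulA //; try exact: mm.
  by rewrite -(matmulA mg mh mhi) h1 matmulm1.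
by rewrite -(matmulA mhi mgi mg) g2 matmulm1.
Qed.
Lemma GL_inv g : is_GL g -> exists h, [/\ is_GL h, matmul g h = I1 & matmul h g = I1].
Proof. by move=> [mg [h [mh [h1 h2]]]]; exists h; split => //; split=> //; exists g. Qed.
Lemma GL_sig g : is_GL g -> is_GL (msig q g).
Proof.
move=> [mg [h [mh [h1 h2]]]]; split; first exact: is_mat_sig.
by exists (msig q h); split; [exact: is_mat_sig|rewrite -!msig_mul // h1 h2 msig1].
Qed.
Lemma GL_bauto g : is_GL g -> exists h, bauto (n := n) (matvec g) (matvec h).
Proof. by move=> [mg [h [mh [h1 h2]]]]; exists h; apply: bauto_mat. Qed.

Lemma lat_klattice g : is_GL g -> klattice (lat g).
Proof. by move=> /GL_bauto[h hg]; apply: (img_klattice hg L0_klattice). Qed.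

Lemma lat_mul g h : is_GL g -> is_GL h -> lat (matmul g h) = img (U := kvec) (matvec g) (lat h).
Proof.
move=> hg hh; rewrite -(@img_comp k n (matvec g) (matvec h) L0).
apply: img_ext (klattice_vec L0_klattice) _ => v hv /=.
by rewrite matvecA //; apply: GL_mat.
Qed.
Lemma lat_sig g : is_GL g -> lat (msig q g) = img (U := kvec) (@vsig k q 'I_n) (lat g).
Proof.
move=> hg; rewrite -(@img_comp k n (@vsig k q 'I_n) (matvec g) L0).
rewrite /lat -/(img (U := kvec) (matvec (msig q g)) L0) -{1}img_vsig_L0.
rewrite -(@img_comp k n (matvec (msig q g)) (@vsig k q 'I_n) L0).
apply: img_ext (klattice_vec L0_klattice) _ => v hv /=.
by rewrite vsig_matvec //; apply: GL_mat.
Qed.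
Lemma lat1 : lat I1 = L0.
Proof. by apply: img_idV (klattice_vec L0_klattice) _ => v hv; apply: matvec1. Qed.

Definition tcoord x := dcoord L0 (lat x.1) x.2.

Lemma tcoord_n0 x : tvalid x -> tcoord x != 0.
Proof. by move=> [hg hw]; apply: dcoord_n0 => //; [exact: L0_klattice|exact: lat_klattice]. Qed.

(** The intermediate vector [g w_h] has coordinate [dfactor] times that of [w_h], and the wedge
    multiplies it by the coordinate of [w_g]. *)
Lemma tmul_tcoord x y z : tvalid x -> tvalid y -> tvalid z -> z.1 = matmul x.1 y.1 ->
  tmul_rel x y z <-> tcoord z = tcoord x * (dfactor (n := n) (matvec x.1) L0 (lat y.1) * tcoord y).
Proof.
move=> [hx wx] [hy wy] [hz wz] e.
have [xi ax] := GL_bauto hx.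
have sx := lat_klattice hx; have sy := lat_klattice hy; have sz := lat_klattice hz.
have ez : img (U := kvec) (matvec x.1) (lat y.1) = lat z.1 by rewrite e lat_mul.
have key w : is_detvec (lat x.1) (lat z.1) w -> transport_rel (matvec x.1) L0 (lat y.1) y.2 w ->
   dcoord (lat x.1) (lat z.1) w = dfactor (n := n) (matvec x.1) L0 (lat y.1) * tcoord y.
  by move=> dw tw; rewrite -ez; apply: (dcoord_transport ax L0_klattice sy wy) => //; rewrite ez.
split.
  move=> [_ [w [dw [tw]]]] /(wedge_dcoord L0_klattice sx sz wx dw wz).
  by rewrite -/(tcoord z) -/(tcoord x) => ->; rewrite key.
move=> hs; split => //.
have [w [dw tw]] := transport_ex ax L0_klattice sy wy.
rewrite ez in dw; exists w; split=> //; split => //.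
by apply/(wedge_dcoord L0_klattice sx sz wx dw wz); rewrite (key w).
Qed.

Definition Phi g : kvec -> kvec := fun v => matvec g (vsig q v).
Definition kappa Y g1 g2 := dfactor (n := n) (matvec Y) L0 (lat g1) / dfactor (n := n) (Phi g2) L0 (lat Y).

Lemma Phi_bauto g : is_GL g -> exists G, bauto (n := n) (Phi g) G.
Proof.
by move=> /GL_bauto[h hg]; eexists; apply: bauto_comp hg bauto_sig.
Qed.

(** Separates the contribution of [sigma_q], produced by [tsig_rel], from that of [g], produced by
    [tmul_rel]. The base lattice stays [L0] because [sigma_q] fixes it. *)
Lemma dfactor_Phi g Y : is_GL g -> is_GL Y ->
  dfactor (n := n) (Phi g) L0 (lat Y) =
  dfactor (n := n) (matvec g) L0 (lat (msig q Y)) * dfactor (n := n) (@vsig k q 'I_n) L0 (lat Y).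
Proof.
move=> hg hY; have [gi ag] := GL_bauto hg.
rewrite [LHS](dfactor_comp ag bauto_sig L0_klattice (lat_klattice hY)).
by rewrite img_vsig_L0 lat_sig.
Qed.

Definition qconj_by Y g1 g2 := is_GL Y /\ matmul g2 (msig q Y) = matmul Y g1.

Lemma tsig_tcoord x y : tvalid x -> tvalid y -> tsig_rel q x y ->
  tcoord y = dfactor (n := n) (@vsig k q 'I_n) L0 (lat x.1) * tcoord x.
Proof.
move=> [hx wx] [hy wy] [e ht].
have sx := lat_klattice hx.
have := dcoord_transport bauto_sig L0_klattice sx wx _ ht.
rewrite img_vsig_L0 -lat_sig // -e; exact.
Qed.
Lemma tsig_ex x : tvalid x -> exists y, tvalid y /\ tsig_rel q x y.
Proof.
move=> [hx wx]; have sx := lat_klattice hx.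
have [w [dw tw]] := transport_ex bauto_sig L0_klattice sx wx.
rewrite img_vsig_L0 -lat_sig // in dw.
by exists (msig q x.1, w); split; split => //=; apply: GL_sig.
Qed.

Lemma tgl_ex g c : is_GL g -> c != 0 -> exists x, [/\ tvalid x, x.1 = g & tcoord x = c].
Proof.
move=> hg c0; have [w [dw e]] := dcoord_ex L0_klattice (lat_klattice hg) c0.
by exists (g, w).
Qed.

(** In coordinates of [x' sigma_q(y) = y x], that of [y] occurs once on each side and cancels; what
    is left are the two factors in [kappa]. *)
Lemma tqconj_kappa x x' : tvalid x -> tvalid x' ->
  tqconj q x x' <-> exists Y, qconj_by Y x.1 x'.1 /\ tcoord x' = kappa Y x.1 x'.1 * tcoord x.
Proof.
move=> vx vx'; have [hx _] := vx; have [hx' _] := vx'.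
have eqn y sy z : tvalid y -> tvalid sy -> tvalid z -> tsig_rel q y sy ->
   z.1 = matmul x'.1 sy.1 -> z.1 = matmul y.1 x.1 ->
   (tmul_rel x' sy z <-> tcoord z = tcoord x' * (dfactor (n := n) (Phi x'.1) L0 (lat y.1) * tcoord y)) /\
   (tmul_rel y x z <-> tcoord z = tcoord y * (dfactor (n := n) (matvec y.1) L0 (lat x.1) * tcoord x)).
  move=> vy vs vz ts e1 e2; rewrite (tmul_tcoord vx' vs vz e1) (tmul_tcoord vy vx vz e2).
  rewrite (tsig_tcoord vy vs ts) dfactor_Phi //; last by case: vy.
  by have [-> _] := ts; rewrite !mulrA.
split.
  move=> [y [sy [z [[vy vs] vz ts t1 t2]]]].
  have [e1 _] := t1; have [e2 _] := t2.
  have [[/(_ t1) s1 _] [/(_ t2) s2 _]] := eqn _ _ _ vy vs vz ts e1 e2.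
  have [hy _] := vy.
  exists y.1; split; first by split => //; have [<- _] := ts; rewrite -e1.
  have [G aP] := Phi_bauto hx'.
  have n1 := dfactor_n0 aP L0_klattice (lat_klattice hy); have n2 := tcoord_n0 vy.
  apply: (mulIf n1); apply: (mulIf n2); rewrite -mulrA -s1 s2 /kappa; field => //.
move=> [Y [[hY eY] hs]].
(* Any lift of [Y] serves, so its coordinate is set to 1; [z] then receives the coordinate that
   [y x] must have. *)
have [y [vy ey sy1]] := tgl_ex hY (oner_neq0 k).
have [sy [vs ts]] := tsig_ex vy.
have [yi ay] := GL_bauto hY.
have nc : dfactor (n := n) (matvec Y) L0 (lat x.1) * tcoord x != 0.
  by rewrite mulf_neq0 ?tcoord_n0 // (dfactor_n0 ay L0_klattice) //; apply: lat_klattice.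
have [z [vz ez sz]] := tgl_ex (GL_mul hY hx) nc.
have e2 : z.1 = matmul y.1 x.1 by rewrite ez ey.
have e1 : z.1 = matmul x'.1 sy.1 by rewrite ez; have [-> _] := ts; rewrite ey.
have [h1 h2] := eqn _ _ _ vy vs vz ts e1 e2.
exists y, sy, z; split=> //; last by apply/h2; rewrite sz sy1 mul1r ey.
have [G aP] := Phi_bauto hx'.
have n1 := dfactor_n0 aP L0_klattice (lat_klattice hY).
by apply/h1; rewrite sz sy1 mulr1 ey hs /kappa; field.
Qed.

(** The matrix relation says that [Y] is an isomorphism of [D_q]-modules, which is the form required
    by [kappa_cocycle]. *)
Lemma qconj_by_Phi Y g1 g2 : is_GL g1 -> is_GL g2 -> qconj_by Y g1 g2 ->
  forall v, V v -> matvec Y (Phi g1 v) = Phi g2 (matvec Y v).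
Proof.
move=> h1 h2 [hY e] v hv; rewrite /Phi; have mG := GL_mat.
rewrite vsig_matvec //; last exact: mG.
have vv := is_vec_sig q hv.
rewrite !matvecA //; try exact: mG; last by apply/mG/GL_sig.
by rewrite e.
Qed.

(** Rewrites [g L0] as a semilinear image, which gives [kappa] the shape treated in
    [kappa_cocycle]. *)
Lemma lat_Phi g : is_GL g -> lat g = img (U := kvec) (Phi g) L0.
Proof.
by move=> hg; rewrite (@img_comp k n (matvec g) (@vsig k q 'I_n) L0) img_vsig_L0.
Qed.

Lemma qconj_by_mul Y Y' g1 g2 g3 : is_GL g1 -> is_GL g2 -> is_GL g3 -> qconj_by Y g1 g2 -> qconj_by Y' g2 g3 ->
  qconj_by (matmul Y' Y) g1 g3.
Proof.
move=> h1 h2 h3 [hY e] [hY' e']; split; first exact: GL_mul.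
have mG := GL_mat; have mS := fun g hg => mG _ (@GL_sig g hg).
rewrite msig_mul //; try exact: mG.
rewrite matmulA //; try exact: mG; try exact: mS.
rewrite e' -(matmulA (mG _ hY') (mG _ h2) (mS _ hY)) e matmulA //; exact: mG.
Qed.

Lemma kappa_mul Y Y' g1 g2 g3 : is_GL g1 -> is_GL g2 -> is_GL g3 -> qconj_by Y g1 g2 -> qconj_by Y' g2 g3 ->
  kappa Y' g2 g3 * kappa Y g1 g2 = kappa (matmul Y' Y) g1 g3.
Proof.
move=> h1 h2 h3 c c'; have [hY _] := c; have [hY' _] := c'.
have [yi ay] := GL_bauto hY; have [yi' ay'] := GL_bauto hY'.
have [G1 a1] := Phi_bauto h1; have [G2 a2] := Phi_bauto h2; have [G3 a3] := Phi_bauto h3.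
have [zi az] := GL_bauto (GL_mul hY' hY).
rewrite /kappa (lat_mul hY' hY) (lat_Phi h1) (lat_Phi h2).
rewrite [LHS](kappa_cocycle ay ay' a1 a2 a3 L0_klattice (qconj_by_Phi h1 h2 c) (qconj_by_Phi h2 h3 c')).
rewrite (@img_comp k n (matvec Y') (matvec Y) L0); congr (_ / _).
apply: dfactor_ext (bauto_comp ay' ay) az _ L0_klattice (img_klattice a1 L0_klattice) => v hv /=.
by rewrite matvecA //; apply: GL_mat.
Qed.

(** Both factors are then taken on the pair [(L0, L0)]. *)
Lemma kappa_fix Y g1 g2 : is_GL Y -> is_GL g2 -> lat Y = L0 -> lat g1 = L0 -> kappa Y g1 g2 = 1.
Proof.
move=> hY h2 eY e1; have [yi ay] := GL_bauto hY; have [G2 a2] := Phi_bauto h2.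
by rewrite /kappa eY e1 (dfactor_refl ay L0_klattice) (dfactor_refl a2 L0_klattice) divr1.
Qed.

Lemma kappa1 g : is_GL g -> kappa I1 g g = 1.
Proof.
move=> hg; have [yi ay] := GL_bauto GL1; have [G2 a2] := Phi_bauto hg.
rewrite /kappa lat1 (dfactor_refl a2 L0_klattice) divr1.
by apply: (dfactor_id ay _ L0_klattice (lat_klattice hg)) => v; apply: matvec1.
Qed.

Lemma qconj_by_inv Y g1 g2 : is_GL g1 -> is_GL g2 -> qconj_by Y g1 g2 ->
  exists Z, [/\ qconj_by Z g2 g1, kappa Z g2 g1 * kappa Y g1 g2 = 1 & matmul Y Z = I1].
Proof.
move=> h1 h2 c; have [hY e] := c; have [Z [hZ e1 e2]] := GL_inv hY.
have mG := GL_mat; have mS := fun g hg => mG _ (@GL_sig g hg).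
have cZ : qconj_by Z g2 g1.
  split => //.
  rewrite -[LHS](matmul1m (is_mat_mul (mG _ h1) (mS _ hZ))) -e2.
  rewrite -(matmulA (mG _ hZ) (mG _ hY) (is_mat_mul (mG _ h1) (mS _ hZ))).
  rewrite (matmulA (mG _ hY) (mG _ h1) (mS _ hZ)) -e.
  rewrite -(matmulA (mG _ h2) (mS _ hY) (mS _ hZ)) -msig_mul //; try exact: mG.
  by rewrite e1 msig1 matmulm1 //; apply: mG.
by exists Z; split=> //; rewrite (kappa_mul h1 h2 h1 c cZ) e2 kappa1.
Qed.

(** * Fibres of the projection, from the values of [kappa] on automorphisms *)

Section Fiber.
Variables (g g0 : mat) (hg : is_GL g) (h0 : is_GL g0) (Y0 : mat) (c0 : qconj_by Y0 g g0).
Let in_fiber x := tvalid x /\ qconj q g x.1.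

Lemma fiber_ex : exists x, in_fiber x.
Proof.
have [x [vx e _]] := tgl_ex hg (oner_neq0 k); exists x; split=> //.
exists I1; split; first exact: GL1.
by rewrite e msig1 matmulm1 ?matmul1m //; apply: GL_mat.
Qed.

Lemma fiber_qconj_by x : in_fiber x -> exists Y, qconj_by Y g0 x.1.
Proof.
move=> [[hx _] [Y [hY e]]]; have [Z [cZ _ _]] := qconj_by_inv hg h0 c0.
by exists (matmul Y Z); apply: (qconj_by_mul h0 hg hx cZ).
Qed.

Lemma kappa_n0 Y g1 g2 : is_GL g1 -> is_GL g2 -> qconj_by Y g1 g2 -> kappa Y g1 g2 != 0.
Proof.
move=> h1 h2 c; have [Z [_ /eqP e _]] := qconj_by_inv h1 h2 c; apply/eqP => e0.
by move: e; rewrite e0 mulr0 eq_sym oner_eq0.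
Qed.

Lemma fiber_one_class : (forall c, c != 0 -> exists T, qconj_by T g0 g0 /\ kappa T g0 g0 = c) ->
  forall x x', in_fiber x -> in_fiber x' -> tqconj q x x'.
Proof.
move=> hT x x' fx fx'.
have [Y1 c1] := fiber_qconj_by fx; have [Y2 c2] := fiber_qconj_by fx'.
have [vx _] := fx; have [vx' _] := fx'; have [hx _] := vx; have [hx' _] := vx'.
have [Z [cZ eZ _]] := qconj_by_inv h0 hx c1.
have n1 := tcoord_n0 vx; have n2 := tcoord_n0 vx'.
have nz := kappa_n0 hx h0 cZ; have ny := kappa_n0 h0 hx' c2.
(* With this value for [T], the composite [Y2 T Z] has [kappa] equal to the ratio of the two
   coordinates. *)
have [|T [cT eT]] := hT (tcoord x' / tcoord x / kappa Y2 g0 x'.1 / kappa Z x.1 g0).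
  by rewrite !mulf_neq0 ?invr_neq0.
apply/tqconj_kappa => //; exists (matmul Y2 (matmul T Z)).
have cTZ := qconj_by_mul hx h0 h0 cZ cT.
split; first exact: (qconj_by_mul hx h0 hx' cTZ).
rewrite -(kappa_mul hx h0 hx' cTZ c2) -(kappa_mul hx h0 h0 cZ cT) eT.
by field; apply/and3P.
Qed.

Lemma tscale_valid x c : c != 0 -> tvalid x -> tvalid (tscale c x).
Proof. by move=> n0 [hx wx]; split => //; apply: scale_detvec. Qed.
Lemma tscale_tcoord x c : c != 0 -> tvalid x -> tcoord (tscale c x) = c * tcoord x.
Proof. by move=> n0 [hx wx]; apply: dcoord_scale => //; [exact: L0_klattice|exact: lat_klattice]. Qed.

Lemma fiber_torsor : (forall T, qconj_by T g0 g0 -> kappa T g0 g0 = 1) ->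
  forall x x', in_fiber x -> in_fiber x' ->
  exists c : k, [/\ c != 0, tqconj q (tscale c x) x' &
    forall c' : k, c' != 0 -> tqconj q (tscale c' x) x' -> c' = c].
Proof.
move=> hT x x' fx fx'.
have [Y1 c1] := fiber_qconj_by fx; have [Y2 c2] := fiber_qconj_by fx'.
have [vx _] := fx; have [vx' _] := fx'; have [hx _] := vx; have [hx' _] := vx'.
have [Z [cZ eZ _]] := qconj_by_inv h0 hx c1.
have [W [cW eW _]] := qconj_by_inv h0 hx' c2.
have n1 := tcoord_n0 vx; have n2 := tcoord_n0 vx'.
have cY := qconj_by_mul hx h0 hx' cZ c2.
have nY := kappa_n0 hx hx' cY; set Y := matmul Y2 Z in cY nY.
(* Composing with [Y1] and [W] turns any conjugator from [x.1] to [x'.1] into an automorphism of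
   [g0], where [kappa] is 1. Hence all conjugators share one value of [kappa], and the scalar is
   forced. *)
have uniq Y' : qconj_by Y' x.1 x'.1 -> kappa W x'.1 g0 * kappa Y' x.1 x'.1 * kappa Y1 g0 x.1 = 1.
  move=> cY'; rewrite (kappa_mul hx hx' h0 cY' cW).
  by rewrite (kappa_mul h0 hx h0 c1 (qconj_by_mul hx hx' h0 cY' cW)) hT //; apply: (qconj_by_mul h0 hx h0 c1 (qconj_by_mul hx hx' h0 cY' cW)).
have nW := kappa_n0 hx' h0 cW; have nY1 := kappa_n0 h0 hx c1.
pose c := tcoord x' / tcoord x / kappa Y x.1 x'.1.
have nc : c != 0 by rewrite !mulf_neq0 ?invr_neq0.
exists c; split=> //.
  apply/tqconj_kappa => //; first exact: tscale_valid.
  exists Y; split => //; rewrite tscale_tcoord //= /c; field; exact/andP.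
move=> c' nc' /(tqconj_kappa (tscale_valid nc' vx) vx')[Y' [cY' /=]].
rewrite tscale_tcoord // => e.
have eY : kappa Y' x.1 x'.1 = kappa Y x.1 x'.1.
  by apply: (mulfI nW); apply: (mulIf nY1); rewrite !uniq.
by rewrite /c e eY; field; apply/andP.
Qed.
End Fiber.
End TGL.

(** * The model matrix *)

Section Model.
Variable k : fieldType.
Local Notation lser := (lser k).

Definition lserC (x : k) : lser := mkl (laurent_const x).
Lemma lserC0 : lserC 0 = 0.
Proof. by apply/lval_inj/funext => m; rewrite /= /lconst; case: eqP. Qed.
Lemma lserC1 : lserC 1 = 1. Proof. exact: lval_inj. Qed.
Lemma lserCD x y : lserC (x + y) = lserC x + lserC y.
Proof. by apply/lval_inj/funext => m; rewrite /= /ladd /lconst; case: eqP; rewrite ?addr0. Qed.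
Lemma lserCM x y : lserC (x * y) = lserC x * lserC y.
Proof.
apply/lval_inj; rewrite [RHS](lmul_const x (laurent_const y)); apply/funext => m /=.
by rewrite /lconst; case: eqP; rewrite ?mulr0.
Qed.
Lemma lserC_nat b : lserC (b : bool)%:R = b%:R.
Proof. by case: b; rewrite ?lserC0 ?lserC1. Qed.
Lemma lserC_sum (J : finType) (F : J -> k) : lserC (\sum_j F j) = \sum_j lserC (F j).
Proof. by elim/big_rec2: _ => [|j x y _ <-]; rewrite ?lserC0 ?lserCD. Qed.

Lemma laurent_mono (x : k) r : is_laurent (lmono x r).
Proof. exact: laurent_supp (@supp_mono k x r). Qed.
Definition lmonom (x : k) (r : int) : lser := mkl (laurent_mono x r).
Lemma lmonomM x y r r' : lmonom x r * lmonom y r' = lmonom (x * y) (r + r').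
Proof.
apply/lval_inj; rewrite [LHS](lmul_mono x r (laurent_mono y r')); apply/funext => m /=.
rewrite /lmono (_ : (m - r == r') = (m == r + r')); last by rewrite subr_eq addrC.
by case: eqP; rewrite ?mulr0.
Qed.
Lemma lmonom0 x : lmonom x 0 = lserC x. Proof. exact: lval_inj. Qed.

Definition Jc (dd a a' : nat) : k :=
  if (a'.+1 < dd)%N then (a == a'.+1)%:R else - ('C(dd, a)%:R * (-1) ^+ (dd - a)%N).
Lemma JentE dd a a' : Jent k dd a a' = lval (lserC (Jc dd a a')).
Proof.
rewrite /Jent /Jc; case: ifP => // _; case: eqP => // _.
by rewrite [lserC _](lserC_nat false).
Qed.

(* Inverse matrices of [Jc] and [Vl], solved from their companion shape. *)
Definition Jinv (dd c a' : nat) : k :=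
  if (c.+1 < dd)%N then (a' == c.+1)%:R - Jc dd c.+1 dd.-1 / Jc dd 0 dd.-1 * (a' == 0%N)%:R
  else (a' == 0%N)%:R / Jc dd 0 dd.-1.

Lemma Jc0_n0 dd : Jc dd.+1 0 dd != 0.
Proof. by rewrite /Jc ltnn bin0 mul1r oppr_eq0 expf_neq0 // oppr_eq0 oner_eq0. Qed.

(** Row 0 meets only the last column, where the entry is a sign. Row [a+1] meets column [a] and the
    last one, and the correction term in [Jinv] cancels the latter. *)
Lemma Jc_inv dd a a' : (a < dd)%N -> (a' < dd)%N ->
  \sum_(c < dd) Jc dd a c * Jinv dd c a' = (a == a')%:R.
Proof.
case: dd => // dd ha ha'; rewrite big_ord_recr /=.
have n0 := Jc0_n0 dd.
rewrite [Jinv _ dd _]/Jinv ltnn /=.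
case: a ha => [|a] ha.
  rewrite big1 ?add0r => [|c _]; last by rewrite /Jc ltnS ltn_ord mul0r.
  by rewrite mulrC divfK // eq_sym.
have {}ha : (a < dd)%N := ha.
rewrite (bigD1 (Ordinal ha)) //= big1 ?addr0 => [|c]; last first.
  move=> hc; rewrite /Jc ltnS ltn_ord eqSS; case: eqP => [e|_]; last by rewrite mul0r.
  by case/eqP: hc; apply/val_inj.
rewrite [Jc _ _ a]/Jc ltnS ha eqxx mul1r /Jinv ltnS ha [a' == _]eq_sym.
by field.
Qed.

Definition Vl (ss : nat) (rr : int) (x : k) (b b' : nat) : lser :=
  if (b'.+1 < ss)%N then (b == b'.+1)%:R else (if b == 0%N then lmonom x rr else 0).
Lemma VentE ss rr x b b' : Vent ss rr x b b' = lval (Vl ss rr x b b').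
Proof.
by rewrite /Vent /Vl; case: ifP => _; case: eqP.
Qed.
Definition Vinv (ss : nat) (rr : int) (x : k) (b b' : nat) : lser :=
  if (b.+1 < ss)%N then (b' == b.+1)%:R else (if b' == 0%N then lmonom x^-1 (- rr) else 0).

Lemma Vl_inv ss rr x b b' : x != 0 -> (b < ss)%N -> (b' < ss)%N ->
  \sum_(c < ss) Vl ss rr x b c * Vinv ss rr x c b' = (b == b')%:R.
Proof.
move=> x0; case: ss => // ss hb hb'; rewrite big_ord_recr /=.
rewrite [Vl _ _ _ _ ss]/Vl [Vinv _ _ _ ss _]/Vinv ltnn.
case: b hb => [|b] hb /=.
  rewrite big1 ?add0r => [|c _]; last by rewrite /Vl ltnS ltn_ord mul0r.
  case: b' hb' => [|b'] _ /=; last by rewrite mulr0.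
  by rewrite lmonomM mulfV // subrr lmonom0 lserC1.
have {}hb : (b < ss)%N := hb.
rewrite mul0r addr0 (bigD1 (Ordinal hb)) //= big1 ?addr0 => [|c]; last first.
  move=> hc; rewrite /Vl ltnS ltn_ord eqSS; case: eqP => [e|_]; last by rewrite mul0r.
  by case/eqP: hc; apply/val_inj.
by rewrite /Vl /Vinv !ltnS hb eqxx mul1r eq_sym.
Qed.

Variables (l : nat) (d s : 'I_l -> nat) (r : 'I_l -> int) (lam : 'I_l -> k).
Hypothesis lam0 : forall i, lam i != 0.
Local Notation idx := (decomp_idx d s).

Definition model_mx (x y : idx) : lser :=
  if tag x == tag y then lserC (Jc (d (tag y)) (tagged x).1 (tagged y).1) *
     Vl (s (tag y)) (r (tag y)) (lam (tag y)) (tagged x).2 (tagged y).2 else 0.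
Definition model_inv (x y : idx) : lser :=
  if tag x == tag y then lserC (Jinv (d (tag x)) (tagged x).1 (tagged y).1) *
     Vinv (s (tag x)) (r (tag x)) (lam (tag x)) (tagged x).2 (tagged y).2 else 0.
Local Notation G := (@dq_mat k (decomp d s r lam)).

Lemma model_mxE : G = fun x y => lval (model_mx x y).
Proof.
apply/funext => x; apply/funext => y; rewrite /= /model_mx; case: eqP => // _.
by rewrite JentE VentE.
Qed.

Lemma sum_idx (R : nmodType) (F : idx -> R) :
  \sum_z F z = \sum_i \sum_(a < d i) \sum_(b < s i) F (existT _ i (a, b)).
Proof.
under [RHS]eq_bigr do rewrite pair_bigA /=.
rewrite (sig_big_dep (fun _ => true) (fun _ _ => true)
  (fun i p => F (existT _ i (p.1, p.2)))) /=.
by apply: eq_bigr => -[i [a b]].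
Qed.

Lemma model_mx_inv x y : \sum_z model_mx x z * model_inv z y = (x == y)%:R.
Proof.
case: x => i [a b]; case: y => j [a' b'].
rewrite sum_idx (bigD1 i) //= [X in _ + X]big1 ?addr0 => [|i' ne]; last first.
  rewrite big1 // => c _; rewrite big1 // => c' _; rewrite /model_mx /= eq_sym (negPf ne).
  by rewrite mul0r.
have [e|ne] := eqVneq i j; last first.
  rewrite big1 => [|c _]; last by rewrite big1 // => c' _; rewrite /model_inv /= (negPf ne) mulr0.
  by rewrite -tag_eqE /tag_eq /= (negPf ne).
subst j; rewrite eq_Tagged /= xpair_eqE.
transitivity ((\sum_(c < d i) lserC (Jc (d i) a c * Jinv (d i) c a')) *
   (\sum_(c' < s i) Vl (s i) (r i) (lam i) b c' * Vinv (s i) (r i) (lam i) c' b')).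
  rewrite mulr_suml; apply: eq_bigr => c _; rewrite mulr_sumr; apply: eq_bigr => c' _.
  rewrite /model_mx /model_inv /= eqxx lserCM; ring.
by rewrite -lserC_sum Jc_inv // Vl_inv // lserC_nat -natrM mulnb.
Qed.

(* The model matrix maps [L0] onto the lattice with these exponents. *)
Definition sexp (x : idx) : int := if (tagged x).2 == 0%N :> nat then r (tag x) else 0.

(** In a [V] block the monomial [t^r] stands in row [b = 0] of the last column; every other nonzero
    entry is a constant in a row with [b > 0]. The [J] factor is constant. *)
Lemma supp_model_mx x y : supp (lval (model_mx x y)) (sexp x).
Proof.
case: x => i [a b]; case: y => j [a' b']; rewrite /model_mx /sexp /=.
have [e|//] := eqVneq i j; subst j; rewrite -[X in supp _ X]add0r.
apply: supp_mul; first exact: supp_const.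
rewrite /Vl; case: ifP => _; last by case: eqP => // _; apply: supp_mono.
by case: (@eqP _ (b : nat) b'.+1) => [->|_] //; apply: supp_const.
Qed.
Lemma supp_model_inv x y : supp (lval (model_inv x y)) (- sexp y).
Proof.
case: x => i [a b]; case: y => j [a' b']; rewrite /model_inv /sexp /=.
have [e|//] := eqVneq i j; subst j; rewrite -[X in supp _ X]add0r.
apply: supp_mul; first exact: supp_const.
rewrite /Vinv; case: ifP => _; last by case: eqP => // _; apply: supp_mono.
by case: (@eqP _ (b' : nat) b.+1) => [->|_] //=; rewrite oppr0; apply: supp_const.
Qed.
End Model.

Section Reindex.
Variables (k : fieldType) (n : nat) (I : finType) (f : 'I_n -> I) (fi : I -> 'I_n).
Hypotheses (fK : cancel f fi) (fiK : cancel fi f).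

Lemma lsum_reindex (F : I -> laur k) : lsum F = lsum (F \o f).
Proof.
apply/funext => m; rewrite /lsum (reindex f) //.
by exists fi => x _; [apply: fK|apply: fiK].
Qed.
Lemma matmul_reindex (J K : finType) (A : mat k J I) (B : mat k I K) :
  matmul A B = matmul (fun j i => A j (f i)) (fun i l => B (f i) l).
Proof. by apply/funext => j; apply/funext => l; rewrite /matmul lsum_reindex. Qed.
Lemma mat1_reindex : (fun i j => @mat1 k I (f i) (f j)) = @mat1 k 'I_n.
Proof.
by apply/funext => i; apply/funext => j; rewrite /mat1 (can_eq fK).
Qed.
End Reindex.

Section Reduction.
Variables (k : fieldType) (q : k) (q0 : q != 0) (n : nat).

(** A [D_q]-isomorphism has an inverse matrix, so the model has exactly [n] basis elements;
    numbering them makes it a matrix in [GL_n]. *)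
Lemma model_reindex (g : mat k 'I_n 'I_n) (I : finType) (G : mat k I I) : is_GL g -> is_mat G ->
  dq_iso q (module_of g) (DqMod G) ->
  exists (f : 'I_n -> I) (fi : I -> 'I_n) Y0, [/\ cancel f fi, cancel fi f,
    is_GL (fun i j => G (f i) (f j)) & qconj_by q Y0 g (fun i j => G (f i) (f j))].
Proof.
move=> hg mG [Y [Z /= [mY mZ YZ ZY hv]]].
have cI : n = #|I|.
  apply/eqP; rewrite -{1}[n]card_ord eqn_leq.
  by rewrite (inverse_card mZ mY ZY) (inverse_card mY mZ YZ).
pose f (i : 'I_n) : I := enum_val (cast_ord cI i).
pose fi (x : I) : 'I_n := cast_ord (esym cI) (enum_rank x).
have fK : cancel f fi by move=> i; rewrite /f /fi enum_valK cast_ordK.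
have fiK : cancel fi f by move=> i; rewrite /f /fi cast_ordKV enum_rankK.
pose Y0 : mat k 'I_n 'I_n := fun i j => Y (f i) j.
pose Z0 : mat k 'I_n 'I_n := fun i j => Z i (f j).
have mg := GL_mat hg.
have E : matmul Y g = matmul G (msig q Y).
  apply: mat_ext; [exact: is_mat_mul|by apply: is_mat_mul => //; apply: is_mat_sig|].
  (* Testing at [sigma_q^-1 u] lets the twisted argument become an arbitrary [u], which leaves an
     identity of matrices. *)
  move=> u hu; have := hv (vsig q^-1 u) (is_vec_sig _ hu).
  rewrite vsig_matvec //; last exact: is_vec_sig.
  by rewrite vsigKV // !matvecA //; apply: is_mat_sig.
have YZ0 : matmul Y0 Z0 = @mat1 k 'I_n.
  by rewrite -(mat1_reindex k fK) -YZ.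
have ZY0 : matmul Z0 Y0 = @mat1 k 'I_n.
  by rewrite -ZY (matmul_reindex fK fiK).
have hY0 : is_GL Y0 by split; [move=> i j; apply: mY|exists Z0; split => // i j; apply: mZ].
have hZ0 : is_GL Z0 by split; [move=> i j; apply: mZ|exists Y0; split => // i j; apply: mY].
pose g0 : mat k 'I_n 'I_n := fun i j => G (f i) (f j).
have mg0 : is_mat g0 by move=> i j; apply: mG.
have E0 : matmul g0 (msig q Y0) = matmul Y0 g.
  apply/funext => i; apply/funext => j; transitivity (matmul G (msig q Y) (f i) j).
    by rewrite (matmul_reindex fK fiK).
  by rewrite -E.
have hg0 : is_GL g0.
  have -> : g0 = matmul (matmul Y0 g) (msig q Z0).
    rewrite -E0 -matmulA //; try by apply: is_mat_sig; apply: GL_mat.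
    by rewrite -msig_mul //; [rewrite YZ0 msig1 matmulm1|apply: GL_mat|apply: GL_mat].
  apply: GL_mul; [exact: GL_mul|exact: GL_sig].
by exists f, fi, Y0.
Qed.
End Reduction.

(** * Values of [kappa] on automorphisms of the model *)

Section Unipotent.
Variable k : fieldType.

Definition Jm d : 'M[k]_d := \matrix_(a, a') Jc k d a a'.

Let e d (a : nat) : 'cV[k]_d := \col_i (i == a :> nat)%:R.

Lemma Jm_e d a : (a < d)%N -> Jm d.+1 *m e d.+1 a = e d.+1 a.+1.
Proof.
move=> ad; apply/colP => i; rewrite !mxE (bigD1 (Ordinal (leqW ad))) //= big1 ?addr0.
  by rewrite !mxE /= eqxx mulr1 /Jc ltnS ad.
by move=> j hj; rewrite !mxE [_ == a](_ : _ = false) ?mulr0 //; apply: contraNF hj => /eqP h; apply/eqP/val_inj.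
Qed.

Lemma Jm_pow_e d a : (a <= d)%N -> Jm d.+1 ^+ a *m e d.+1 0 = e d.+1 a.
Proof.
elim: a => [|a IH] ha; first by rewrite expr0 mul1mx.
by rewrite exprS -mulmxA IH ?Jm_e // ltnW.
Qed.

(* [e_0] is a cyclic vector for the companion matrix of [(X - 1)^(d+1)]. *)
Lemma Jm_e0 d : (Jm d.+1 - 1) ^+ d.+1 *m e d.+1 0 = 0.
Proof.
rewrite addrC exprDn_comm; last by apply/commr_sym/commrN1.
rewrite mulmx_suml big_ord_recr /= subnn expr0 binn mul1r mulr1n exprS -mulmxA Jm_pow_e //.
have -> : Jm d.+1 *m e d.+1 d = - \sum_(i < d.+1) ((-1) ^+ (d.+1 - i) * 'C(d.+1, i)%:R) *: e d.+1 i.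
  apply/colP => i; rewrite !mxE summxE (bigD1 (ord_max : 'I_d.+1)) //= big1 ?addr0.
    rewrite (bigD1 i) //= big1 ?addr0.
      by rewrite !mxE !eqxx !mulr1 /Jc ltnn mulrC.
    by move=> j hj; rewrite !mxE eq_sym [_ == _](negPf (_ : (j != i))) ?mulr0.
  move=> j hj; rewrite !mxE [_ == d](_ : _ = false) ?mulr0 //.
  by apply: contraNF hj => /eqP h; apply/eqP/val_inj.
apply/eqP; rewrite subr_eq0; apply/eqP; apply: eq_bigr => i _.
have -> : (-1) ^+ (d.+1 - i) = ((-1) ^+ (d.+1 - i))%:M :> 'M[k]_d.+1.
  by rewrite rmorphXn rmorphN1.
rewrite [_%:M * _]mul_scalar_mx -scaler_nat -!scalemxAl scalerA mulrC.
by rewrite Jm_pow_e // -ltnS.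
Qed.

(** The power commutes with the companion matrix and kills the cyclic vector [e_0], hence kills each
    [e_j], its image under the [j]-th power. *)
Lemma Jm_unip d : (Jm d.+1 - 1) ^+ d.+1 = 0.
Proof.
apply/matrixP => i j; rewrite [RHS]mxE.
have cJ : GRing.comm ((Jm d.+1 - 1) ^+ d.+1) (Jm d.+1 ^+ j).
  apply: commrX; apply: commr_sym; apply: commrX; apply: commrB; [exact: commr_refl|exact: commr1].
have := congr1 (mulmx (Jm d.+1 ^+ j)) (Jm_e0 d).
rewrite mulmxA mulmx0 -[_ *m _ ^+ d.+1]cJ -mulmxA Jm_pow_e; last by rewrite -ltnS.
move=> /(congr1 (fun v : 'cV_d.+1 => v i 0)); rewrite !mxE (bigD1 j) //= big1 ?addr0.
  by rewrite !mxE eqxx mulr1.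
by move=> j' hj; rewrite !mxE [_ == _ :> nat](negPf (_ : (j' != j))) ?mulr0.
Qed.

(* Distinct eigenvalues: [nu Jm d1 - 1] is a unit plus a nilpotent, while
   [(Jm d2 - 1) ^+ d2 = 0]. *)
Lemma Jm_sylvester d1 d2 (nu : k) (X : 'M_(d1, d2)) : (0 < d1)%N -> (0 < d2)%N -> nu != 1 ->
  nu *: (Jm d1 *m X) = X *m Jm d2 -> X = 0.
Proof.
case: d1 X => // d1 X _; case: d2 X => // d2 X _ nu1 hX.
pose N := Jm d1.+1 - 1; pose A := nu *: Jm d1.+1 - 1.
(* For [m = 1] this is the hypothesis rearranged; at the size of the second block the right side
   vanishes. *)
have hA m : A ^+ m *m X = X *m (Jm d2.+1 - 1) ^+ m.
  elim: m => [|m IH]; first by rewrite !expr0 mul1mx mulmx1.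
  rewrite exprS -mulmxA IH exprS mulmxA [X in _ = X]mulmxA; congr (_ *m _).
  by rewrite mulmxBl mulmxBr mul1mx mulmx1 -scalemxAl hX.
have := hA d2.+1; rewrite Jm_unip mulmx0.
(* Geometric sum: [A = x - y] with [x = nu - 1] scalar and [y = - nu N] nilpotent, so [A] divides
   [x^m - y^m], which is the scalar [x^m] at the size of the first block. *)
have [B hB] : exists B, B * A = ((nu - 1) ^+ d1.+1)%:M.
  exists (\sum_(i < d1.+1) (nu - 1)%:M ^+ (d1.+1.-1 - i) * (- nu *: N) ^+ i).
  have cm : GRing.comm (nu - 1)%:M (- nu *: N) by apply: comm_scalar_mx.
  have EA : A = (nu - 1)%:M - (- nu *: N).
    by apply/matrixP => i j; rewrite !mxE; case: (i == j); rewrite ?mulr1n ?mulr0n; ring.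
  have := subrXX_comm d1.+1 cm.
  rewrite exprZn Jm_unip scaler0 subr0 -EA => E.
  rewrite rmorphXn /= E; apply: commr_sym.
  have cA1 : GRing.comm A (nu - 1)%:M by apply: commr_sym; apply: comm_scalar_mx.
  have cA2 : GRing.comm A (- nu *: N).
    by rewrite EA; apply: commr_sym; apply: commrB; [apply: commr_sym|exact: commr_refl].
  by apply: commr_sum => i _; apply: commrM; apply: commrX.
suff key m : A ^+ m *m X = 0 -> X = 0 by apply: key.
elim: m => [|m IH]; first by rewrite expr0 mul1mx.
rewrite exprS -mulmxA => /(congr1 (mulmx B)); rewrite mulmx0 mulmxA.
rewrite [B *m A]hB mul_scalar_mx => /eqP; rewrite scaler_eq0 expf_eq0 /= subr_eq0 (negPf nu1).
by move/eqP/IH.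
Qed.
End Unipotent.

(** * Constant diagonal matrices acting on coordinate lattices *)

Section Diagonal.
Variables (k : fieldType) (n : nat).
Local Notation kvec := (@kvec k n).
Local Notation L0 := (@L0 k n).

Definition diaglat (e : 'I_n -> int) : vset k n := fun v => forall i m, m < e i -> v i m = 0.

Lemma diaglat_klattice e : klattice (diaglat e).
Proof.
pose N := (\sum_i absz (e i))%N.
have hN i : (absz (e i) <= N)%N by rewrite /N (bigD1 i) ?leq_addr.
split; last first.
  exists N%:Z, (- N%:Z); split => v hv i m hm; apply: hv; have := hN i; lia.
split=> [//|x v w hv hw i m hm].
by rewrite [LHS](_ : _ = x * v i m + w i m) // hv // hw // mulr0 addr0.
Qed.
Lemma diaglat0 : diaglat (fun _ => 0) = L0.
Proof. by rewrite L0_tlat. Qed.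

Definition cdiag (y : 'I_n -> k) : mat k 'I_n 'I_n := fun i j => lval ((i == j)%:R * lserC (y i)).
Lemma is_mat_dg y : is_mat (cdiag y). Proof. by move=> i j; apply: lvalP. Qed.
Lemma cdiag_vec y v : is_vec v -> matvec (cdiag y) v = fun i m => y i * v i m.
Proof.
move=> /lift_vec[v' ->]; rewrite matvec_lift; apply/funext => i.
rewrite -[RHS](lmul_const (y i) (lvalP (v' i))) -[RHS]/(lval (lserC (y i) * v' i)); congr lval.
rewrite -[RHS](sum_delta (fun j => lserC (y i) * v' j) i).
by apply: eq_bigr => j _; rewrite mulrA.
Qed.
Lemma cdiag_mul y y' : matmul (cdiag y) (cdiag y') = cdiag (fun i => y i * y' i).
Proof.
rewrite matmul_lift; apply/funext => i; apply/funext => j; congr lval.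
under eq_bigr do rewrite -mulrA.
by rewrite sum_delta mulrCA -lserCM.
Qed.
Lemma dg1 : cdiag (fun _ => 1) = @mat1 k 'I_n.
Proof.
by rewrite mat1_lift; apply/funext => i; apply/funext => j; rewrite /cdiag lserC1 mulr1.
Qed.
Lemma cdiag_inv y : (forall i, y i != 0) -> matmul (cdiag y) (cdiag (fun i => (y i)^-1)) = @mat1 k 'I_n /\
  matmul (cdiag (fun i => (y i)^-1)) (cdiag y) = @mat1 k 'I_n.
Proof.
move=> y0; rewrite !cdiag_mul -dg1.
by split; congr cdiag; apply/funext => i; rewrite ?mulfV ?mulVf.
Qed.
Lemma cdiag_GL y : (forall i, y i != 0) -> is_GL (cdiag y).
Proof.
move=> y0; split; first exact: is_mat_dg.
exists (cdiag (fun i => (y i)^-1)); split; [exact: is_mat_dg|exact: cdiag_inv].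
Qed.

Lemma cdiag_img y e : (forall i, y i != 0) -> img (U := kvec) (matvec (cdiag y)) (diaglat e) = diaglat e.
Proof.
move=> y0; have vD := klattice_vec (diaglat_klattice e).
apply/funext => v; apply/propext; split.
  move=> [w [hw ->]] i m hm; rewrite cdiag_vec; last exact: vD.
  by rewrite hw // mulr0.
move=> hv; pose w : vec k 'I_n := fun i m => (y i)^-1 * v i m.
have hw : diaglat e w by move=> i m hm; rewrite /w hv // mulr0.
exists w; split => //; rewrite cdiag_vec; last exact: vD.
by apply/funext => i; apply/funext => m; rewrite /w mulrA mulfV // mul1r.
Qed.
Lemma cdiag_lat y : (forall i, y i != 0) -> lat (cdiag y) = L0.
Proof. by move=> y0; rewrite -diaglat0 -(cdiag_img _ y0) diaglat0. Qed.

Lemma rho_scalar (phi psi : kvec -> kvec) (L M : vset k n) d (h : 'I_d -> kvec) c : bauto phi psi -> klattice L -> klattice M ->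
  subs (U := kvec) M L -> img (U := kvec) phi L = L -> img (U := kvec) phi M = M ->
  isbasis (U := kvec) L M h -> (forall j, phi (h j) = c *: h j) -> rho phi L M = c ^+ d.
Proof.
move=> hp sL sM sub eL eM hh hc.
rewrite (rhoE hp sL sM sub hh).
have hb := img_basis hp sL sM hh; rewrite eL eM in hb *.
have ht : ltrans (U := kvec) M (phi \o h) h c%:M.
  move=> j; rewrite /= hc.
  have -> : lincomb (fun i => (c%:M : 'M_d) i j) h = c *: h j.
    rewrite /lincomb (bigD1 j) //= mxE eqxx mulr1n big1 ?addr0 // => i /negPf ne.
    by rewrite mxE ne scale0r.
  by rewrite subrr; apply: subsp0; apply: klattice_subsp.
rewrite (vol_change sL sM sub hh hb ht).
by rewrite sdetE det_scalar mulrC mulKf // vol_n0.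
Qed.

Lemma diaglat_step_basis e i : isbasis (U := kvec) (diaglat e) (diaglat (fun j => e j + (j == i)%:Z))
  (fun _ : 'I_1 => @unitvec k n (e i) i).
Proof.
have E c j m : lincomb c (fun _ : 'I_1 => @unitvec k n (e i) i) j m =
    c ord0 * (if (j == i) && (m == e i) then 1 else 0) by rewrite /lincomb big_ord1.
split.
- move=> _ j m hm; rewrite /unitvec; case: eqP => //= ej; case: eqP => // em.
  by move: hm; rewrite ej em ltxx.
- move=> v hv; exists (fun _ => v i (e i)) => j m hm.
  transitivity (v j m - v i (e i) * (if (j == i) && (m == e i) then 1 else 0)).
    by rewrite -(E (fun _ => v i (e i)) j m).
  have [ej|ne] := eqVneq j i; last first.
    by rewrite mulr0 subr0; apply: hv; move: hm; rewrite (negPf ne) addr0.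
  subst j; rewrite eqxx in hm; case: eqP => [->|ne]; first by rewrite mulr1 subrr.
  rewrite mulr0 subr0; apply: hv; lia.
- move=> c h j; rewrite [j]ord1; have := h i (e i); rewrite E !eqxx mulr1 => -> //; lia.
Qed.

(** The second lattice is the smaller one, so the eigenvalue [y i] on the line spanned by
    [t^(e i) e_i] lands in the denominator. *)
Lemma dfactor_diag_step y e i : (forall i, y i != 0) ->
  dfactor (n := n) (matvec (cdiag y)) (diaglat e) (diaglat (fun j => e j + (j == i)%:Z)) = (y i)^-1.
Proof.
move=> y0; have [yi ay] := GL_bauto (cdiag_GL y0).
have s1 := diaglat_klattice e; have s2 := diaglat_klattice (fun j => e j + (j == i)%:Z).
have sub : subs (U := kvec) (diaglat (fun j => e j + (j == i)%:Z)) (diaglat e).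
  by move=> v hv j m hm; apply: hv; lia.
have sub2 : subs (U := kvec) (diaglat (fun j => e j + (j == i)%:Z)) (diaglat (fun j => e j + (j == i)%:Z)) by [].
rewrite (dfactorE ay s1 s2 s2 sub sub2).
rewrite (rho_scalar ay s1 s2 sub (cdiag_img _ y0) (cdiag_img _ y0) (diaglat_step_basis e i) (c := y i)).
  rewrite (@rho_scalar _ _ _ _ 0 (fun _ => 0) 1 ay s2 s2 sub2 (cdiag_img _ y0) (cdiag_img _ y0)).
  - by rewrite expr0 expr1 mul1r.
  - split => [[]//|v hv|c _ []//].
    by exists (fun _ => 0); rewrite /lincomb big_ord0 subr0.
  - by case.
move=> _; rewrite cdiag_vec; last by move=> j; exists (e i) => m hm; rewrite /unitvec (lt_eqF hm) andbF.
apply/funext => j; apply/funext => m; rewrite /unitvec.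
transitivity (y i * (if (j == i) && (m == e i) then 1 else 0)) => //.
by case: eqP => [->|_] //=; rewrite !mulr0.
Qed.

(** Induction on [Z^n] in disguise: coordinates are set to zero one after the other, by unit shifts
    in the direction given by their sign. *)
Lemma shift_const (T : Type) (F : ('I_n -> int) -> T) :
  (forall e i, F (fun j => e j + (j == i)%:Z) = F e) -> forall e, F e = F (fun _ => 0).
Proof.
move=> h.
have hn (m : nat) e i : F (fun j => e j + (j == i)%:Z * m%:Z) = F e.
  elim: m => [|m <-]; first by congr F; apply/funext => j; lia.
  rewrite -[RHS](h _ i); congr F; apply/funext => j; case: (j == i) => /=; lia.
have hz e i : F (fun j => if j == i then 0 else e j) = F e.
  have [le|/ltW le] := leP 0 (e i).
    rewrite -[LHS](hn (absz (e i)) _ i); congr F; apply/funext => j.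
    by case: eqP => [->|] /=; lia.
  rewrite -[RHS](hn (absz (e i)) _ i); congr F; apply/funext => j.
  by case: eqP => [->|] /=; lia.
move=> e; have hs (t : seq 'I_n) : F (fun j => if j \in t then 0 else e j) = F e.
  elim: t => [|i t IH]; first by congr F; apply/funext.
  rewrite -IH -[RHS](hz _ i); congr F; apply/funext => j; rewrite in_cons.
  by case: eqP.
by rewrite -(hs (enum 'I_n)); congr F; apply/funext => j; rewrite mem_enum.
Qed.

Lemma dfactor_diag y e : (forall i, y i != 0) ->
  dfactor (n := n) (matvec (cdiag y)) L0 (diaglat e) = \prod_i (y i) ^ (- e i).
Proof.
move=> y0; have [yi ay] := GL_bauto (cdiag_GL y0); have s0 := L0_klattice k n.
(* The product of the factor with the inverse of its expected value should be constant in [e], and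
   each unit shift checks this. *)
pose F e := dfactor (n := n) (matvec (cdiag y)) L0 (diaglat e) * \prod_i (y i) ^ (e i).
have : F e = F (fun _ => 0).
  apply: shift_const => {}e i; rewrite /F.
  rewrite -(dfactor_add ay s0 (diaglat_klattice e) (diaglat_klattice _)) dfactor_diag_step //.
  have -> : \prod_i0 y i0 ^ (e i0 + (i0 == i)%:Z) = y i * \prod_i0 y i0 ^ e i0.
    under eq_bigr do rewrite expfzDr //.
    rewrite big_split /= mulrC; congr (_ * _).
    rewrite (bigD1 i) //= eqxx expr1z big1 ?mulr1 // => j /negPf ->.
    by rewrite expr0z.
  by rewrite mulrA mulfVK.
rewrite /F diaglat0 (dfactor_refl ay s0) mul1r [X in _ = X -> _]big1 => [E|i _]; last by [].
have n0 : \prod_i y i ^ e i != 0 by apply/prodf_neq0 => i _; rewrite expfz_neq0.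
apply: (mulIf n0); rewrite E -big_split /= big1 // => i _.
by rewrite -expfzDr // addNr expr0z.
Qed.
End Diagonal.

Section GLinv.
Variables (k : fieldType) (n : nat).
Lemma GL_rinv (A B : mat k 'I_n 'I_n) : is_mat A -> is_mat B -> matmul A B = @mat1 k 'I_n -> is_GL A.
Proof.
move=> mA mB AB; split => //; exists B; split=> //; split => //.
move: mA mB AB => /lift_mat[A' ->] /lift_mat[B' ->]; rewrite !matmul_lift mat1_lift => h.
have := @mulmx1C _ n (\matrix_(i, j) A' i j) (\matrix_(i, j) B' i j).
have -> : (\matrix_(i, j) A' i j) *m (\matrix_(i, j) B' i j) = 1%:M.
  apply/matrixP => i j; rewrite !mxE.
  have /lval_inj <- := congr1 (fun F : mat k 'I_n 'I_n => F i j) h.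
  by apply: eq_bigr => u _; rewrite !mxE.
move=> /(_ erefl)/matrixP E; apply/funext => i; apply/funext => j; congr lval.
by have := E i j; rewrite !mxE => <-; apply: eq_bigr => u _; rewrite !mxE.
Qed.
End GLinv.

(** * The model as an element of [GL_n], and its lattice *)

Section ModelLat.
Variables (k : fieldType) (n l : nat) (d s : 'I_l -> nat).
Local Notation idx := (decomp_idx d s).
Variables (f : 'I_n -> idx) (fi : idx -> 'I_n).
Hypotheses (fK : cancel f fi) (fiK : cancel fi f).
Variables (r : 'I_l -> int) (lam : 'I_l -> k).
Hypothesis lam0 : forall i, lam i != 0.
Local Notation g0 := (fun i j : 'I_n => @dq_mat k (decomp d s r lam) (f i) (f j)).

Let H0 : mat k 'I_n 'I_n := fun i j => lval (model_inv r lam (f i) (f j)).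

Lemma modelE : g0 = fun i j => lval (model_mx r lam (f i) (f j)).
Proof. by rewrite model_mxE. Qed.
Lemma model_mat : is_mat g0. Proof. by rewrite modelE => i j; apply: lvalP. Qed.
Lemma model_inv_r : matmul g0 H0 = @mat1 k 'I_n.
Proof.
rewrite -(mat1_reindex k fK) modelE matmul_lift mat1_lift.
apply/funext => i; apply/funext => j; congr lval.
rewrite -(model_mx_inv r lam0) [RHS](reindex f) //.
by exists fi => x _; [apply: fK|apply: fiK].
Qed.
Lemma model_GL : is_GL g0.
Proof. by apply: GL_rinv model_inv_r => [|i j]; [exact: model_mat|apply: lvalP]. Qed.

Lemma supp_matvec (A : mat k 'I_n 'I_n) (e e' : 'I_n -> int) v :
  (forall i j, supp (A i j) (e i - e' j)) -> diaglat e' v -> diaglat e (matvec A v).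
Proof.
move=> hA hv i m hm; rewrite /matvec /lsum big1 // => j _.
by apply: (supp_mul (hA i j) (b := e' j)); [move=> u; apply: hv | lia].
Qed.

(** The supports of the entries show that [g0] maps [L0] into this lattice and that its inverse maps
    the lattice back into [L0]. *)
Lemma lat_model : lat g0 = diaglat (fun i => sexp r (f i)).
Proof.
apply/funext => v; apply/propext; split.
  move=> [u [hu ->]]; rewrite -diaglat0 in hu; apply: supp_matvec hu => i j.
  by rewrite subr0 model_mxE; apply: supp_model_mx.
move=> hv; exists (matvec H0 v).
have vv : is_vec v := klattice_vec (@diaglat_klattice k n _) hv.
have mH : is_mat H0 by move=> i j; apply: lvalP.
rewrite matvecA //; last exact: model_mat.
rewrite model_inv_r matvec1 // -diaglat0; split=> //.
by apply: supp_matvec hv => i j; rewrite sub0r; apply: supp_model_inv.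
Qed.
End ModelLat.

(** * The two cases of the theorem *)

Section Cases.
Variables (k : closedFieldType) (q : k) (q0 : q != 0).
Hypothesis q_not_root : forall m : nat, (0 < m)%N -> q ^+ m != 1.
Variables (n l : nat) (d s : 'I_l -> nat).
Hypotheses (d_pos : forall i, (0 < d i)%N) (s_pos : forall i, (0 < s i)%N).
Local Notation idx := (decomp_idx d s).
Variables (f : 'I_n -> idx) (fi : idx -> 'I_n).
Hypotheses (fK : cancel f fi) (fiK : cancel fi f).
Local Notation model r lam :=
  (fun i j : 'I_n => @dq_mat k (decomp d s r lam) (f i) (f j)).

Lemma lsig_kc (c : k) : lsig q (lval (lserC c)) = lval (lserC c).
Proof.
apply/funext => m; rewrite /lsig /= /lconst; case: eqP => [->|_]; last by rewrite mulr0.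
by rewrite expr0z mul1r.
Qed.
Lemma cdiag_sig (y : 'I_n -> k) : msig q (cdiag y) = cdiag y.
Proof.
by apply/funext => i; apply/funext => j; rewrite /msig /cdiag -lserC_nat -lserCM lsig_kc.
Qed.

Lemma closed_root (m : nat) (c : k) : (0 < m)%N -> exists a, a ^+ m = c.
Proof.
move=> m0; have [a ha] := solve_monicpoly (fun i => if i == 0%N then c else 0) m0.
exists a; rewrite ha; case: m m0 ha => // m _ _.
rewrite big_ord_recl big1 ?addr0 => [|i _]; last by rewrite mul0r.
by rewrite eqxx expr0 mulr1.
Qed.

(** A scalar on one block commutes with the block diagonal model; being constant, it is fixed by
    [sigma_q] and preserves [L0]. Its [kappa] is therefore the [dfactor] read from the exponents of
    the model lattice. *)
Lemma kappa_surj r lam i0 c : (forall i, lam i != 0) -> r i0 != 0 -> c != 0 ->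
  exists T, qconj_by q T (model r lam) (model r lam) /\ kappa q T (model r lam) (model r lam) = c.
Proof.
move=> lam0 r0 c0.
(* The rows of block [i0] with [b = 0], where the exponent is [r i0]. There are [d i0] of them, and
   for extracting the root it is enough that their number is positive. *)
pose P i := (tag (f i) == i0) && ((tagged (f i)).2 == 0%N :> nat).
have P0 : (0 < #|P|)%N.
  apply/card_gt0P; exists (fi (existT _ i0 (Ordinal (d_pos i0), Ordinal (s_pos i0)))).
  by rewrite unfold_in /P fiK /= eqxx.
have [a ha] : exists a : k, (a ^ (- r i0)) ^+ #|P| = c.
  (* The sign of [r i0] decides whether a root of [c] or of its inverse is taken. *)
  case: (r i0) r0 => m r0.
    have [|a ha] := @closed_root (m * #|P|) c^-1; first by rewrite muln_gt0 P0 andbT lt0n.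
    by exists a; rewrite -exprnN -exprVn -exprM exprVn ha invrK.
  have [|a ha] := @closed_root (m.+1 * #|P|) c; first by rewrite muln_gt0 P0.
  by exists a; rewrite NegzE opprK -exprnP -exprM.
have a0 : a != 0.
  apply: contraNneq c0 => a0; rewrite -ha a0 exp0rz oppr_eq0 (negPf r0) expr0n.
  by case: #|P| P0.
pose y i := if tag (f i) == i0 then a else 1.
have y0 i : y i != 0 by rewrite /y; case: ifP; rewrite ?oner_eq0.
have hg := model_GL fK fiK r lam0.
have cT : qconj_by q (cdiag y) (model r lam) (model r lam).
  split; first exact: cdiag_GL.
  rewrite cdiag_sig modelE !matmul_lift; apply/funext => i; apply/funext => j; congr lval.
  under [RHS]eq_bigr do rewrite -mulrA.
  rewrite sum_delta.
  transitivity (\sum_j0 (j == j0)%:R * (model_mx r lam (f i) (f j0) * lserC (y j0))).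
    by apply: eq_bigr => j0 _; rewrite eq_sym mulrCA.
  rewrite sum_delta mulrC /model_mx; case: eqP => [e|_]; last by rewrite !mulr0.
  suff -> : y j = y i by [].
  by rewrite /y e.
exists (cdiag y); split=> //.
have [G aG] := Phi_bauto q0 hg.
rewrite /kappa cdiag_lat // (dfactor_refl aG (L0_klattice k n)) divr1.
rewrite (lat_model fK fiK r lam0) dfactor_diag // -ha -prodr_const.
rewrite [RHS]big_mkcond; apply: eq_bigr => i _; rewrite unfold_in /P /y /sexp.
case: eqP => [e|_] /=; last by rewrite exp1rz.
by rewrite -e; case: eqP => _ //=; rewrite oppr0.
Qed.

(** * Regular case: [r_i = 0] and [s_i = 1] for all [i] *)

Section Regular.
Hypothesis s1 : forall i, s i = 1%N.
Let r0 : 'I_l -> int := fun _ => 0.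

Lemma model_mx_const lam (x y : idx) : model_mx r0 lam x y =
  lserC (if tag x == tag y then Jc k (d (tag y)) (tagged x).1 (tagged y).1 * lam (tag y) else 0) :> lser k.
Proof.
rewrite /model_mx; case: eqP => [e|_]; last by rewrite lserC0.
rewrite lserCM; congr (_ * _).
have z (i : 'I_l) (b : 'I_(s i)) : b = 0%N :> nat.
  by have := ltn_ord b; rewrite {2}s1 ltnS leqn0 => /eqP.
by rewrite (z _ (tagged x).2) (z _ (tagged y).2) /Vl s1 ltnn /= lmonom0.
Qed.

Lemma q_inj (m : int) : q ^ m = 1 -> m = 0.
Proof.
case: m => [[//|m]|m].
  by rewrite -exprnP => /eqP; rewrite (negPf (q_not_root _)).
by rewrite NegzE -exprnN => /eqP; rewrite invr_eq1 (negPf (q_not_root _)).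
Qed.

(** Parameters in one class modulo [q^Z] must coincide; this keeps the ratios [q^m lam_i / lam_j]
    with [m != 0] away from 1. *)
Definition normalised (lam : 'I_l -> k) := forall i j (m : int), lam i = q ^ m * lam j -> m = 0.

Lemma normalise lam : (forall i, lam i != 0) -> exists lam' (a : 'I_l -> int),
  [/\ forall i, lam' i != 0, normalised lam' & forall i, lam i = q ^ (a i) * lam' i].
Proof.
move=> lam0.
pose cls (x : k) := fun y => exists a : int, x = q ^ a * y.
(* The choice is made from the class as a predicate, so equivalent parameters receive the same
   representative. *)
pose rep x := epsilon (inhabits 0) (cls x).
have repP x : cls x (rep x).
  by apply: epsilon_spec; exists x, 0; rewrite expr0z mul1r.
have cls_eq x y : cls x y -> cls x = cls y.
  move=> [a ->]; apply/funext => z; apply/propext; split => -[b hb].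
    exists (b - a); apply: (mulfI (expfz_neq0 a q0)).
    by rewrite hb mulrA -expfzDr // addrC subrK.
  by exists (a + b); rewrite hb expfzDr // mulrA.
have [a ha] := choice (fun i => repP (lam i)).
exists (fun i => rep (lam i)), a.
have n0 i : rep (lam i) != 0.
  by apply: contraNneq (lam0 i) => e; rewrite (ha i) e mulr0.
split=> // i j m e.
have E : cls (lam i) = cls (lam j).
  rewrite (cls_eq _ _ (repP (lam i))) (cls_eq _ _ (repP (lam j))).
  by apply: cls_eq; exists m.
have {}E : rep (lam i) = rep (lam j) by rewrite /rep E.
by apply: q_inj; apply: (mulIf (n0 j)); rewrite -e mul1r E.
Qed.

(** The conjugator is [t^(a i)] on the [i]-th block: as [sigma_q(t^a) = q^a t^a], it moves the
    parameter by the factor [q^a]. *)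
Lemma normalise_qconj_by lam lam' a : (forall i, lam i = q ^ (a i) * lam' i) ->
  exists P, qconj_by q P (model r0 lam) (model r0 lam').
Proof.
move=> ha.
pose D (b : 'I_n -> int) : 'I_n -> 'I_n -> lser k := fun i j => (i == j)%:R * lmonom 1 (b i).
pose b i := a (tag (f i)).
pose P : mat k 'I_n 'I_n := fun i j => lval (D b i j).
have mP : is_mat P by move=> i j; apply: lvalP.
exists P; split.
  apply: (@GL_rinv k n P (fun i j => lval (D (fun i => - b i) i j))) => //.
    by move=> i j; apply: lvalP.
  rewrite matmul_lift mat1_lift; apply/funext => i; apply/funext => j; congr lval.
  rewrite /D; under eq_bigr do rewrite -mulrA.
  by rewrite sum_delta mulrCA lmonomM mulr1 subrr lmonom0 lserC1 mulr1.
have -> : msig q P = fun i j => lval ((i == j)%:R * lmonom (q ^ (b i)) (b i)).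
  apply/funext => i; apply/funext => j; rewrite /msig /P /D.
  case: (i == j); last first.
    by rewrite !mul0r; apply/funext => m; rewrite /lsig /= /lzero mulr0.
  rewrite !mul1r; apply/funext => m; rewrite /lsig /= /lmono.
  by case: eqP => [->|_]; rewrite ?mulr1 ?mulr0.
rewrite !modelE /P !matmul_lift; apply/funext => i; apply/funext => j; congr lval.
under [RHS]eq_bigr do rewrite /D -mulrA.
rewrite sum_delta.
transitivity (\sum_j0 (j == j0)%:R * (model_mx r0 lam' (f i) (f j0) * lmonom (q ^ (b j0)) (b j0))).
  by apply: eq_bigr => j0 _; rewrite eq_sym mulrCA.
rewrite sum_delta !model_mx_const; case: eqP => [e|_]; last by rewrite lserC0 mul0r mulr0.
have -> : b i = b j by rewrite /b e.
by rewrite -!lmonom0 !lmonomM ha addr0 add0r mul1r /b; congr lmonom; ring.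
Qed.

Section Constant.
Variable lam : 'I_l -> k.
Hypotheses (lam0 : forall i, lam i != 0) (hn : normalised lam).
Let g0 : mat k 'I_n 'I_n := model r0 lam.
Let Gam (x y : idx) : k :=
  if tag x == tag y then Jc k (d (tag y)) (tagged x).1 (tagged y).1 * lam (tag y) else 0.

(** The model is constant, so the conjugation equation splits along powers of [t], and [sigma_q]
    contributes only [q^m]. *)
Lemma qconj_by_coef T m i j : qconj_by q T g0 g0 ->
  \sum_u Gam (f i) (f u) * (q ^ m * T u j m) = \sum_u T i u m * Gam (f u) (f j).
Proof.
move=> [hT /(congr1 (fun F : mat k 'I_n 'I_n => F i j m))].
have E u v : g0 u v = lconst (Gam (f u) (f v)) by rewrite /g0 model_mxE model_mx_const.
have mT := GL_mat hT.
rewrite /matmul /lsum => e.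
transitivity (\sum_u lmul (g0 i u) (msig q T u j) m).
  by apply: eq_bigr => u _; rewrite E lmul_const //; apply: is_mat_sig.
rewrite e; apply: eq_bigr => u _; rewrite E lmulC //; last exact: laurent_const.
by rewrite lmul_const // mulrC.
Qed.

(** Each block of the coefficient of [t^m] solves a Sylvester equation between unipotent matrices
    with ratio [q^m lam_i1 / lam_i2]. Normalisation makes this ratio different from 1, so
    [Jm_sylvester] applies. *)
Lemma qconj_by_const T i j (m : int) : qconj_by q T g0 g0 -> m != 0 -> T i j m = 0.
Proof.
move=> cT m0.
(* Since [s i = 1], the [V] index has the single value [z i], and only the indices of the [J]
   factors remain. *)
pose z i : 'I_(s i) := Ordinal (s_pos i).
have zE i1 (b : 'I_(s i1)) : b = z i1.
  by apply/val_inj => /=; have := ltn_ord b; rewrite {2}s1 ltnS leqn0 => /eqP.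
pose S i1 i2 : 'M[k]_(d i1, d i2) :=
  \matrix_(a, a') T (fi (existT _ i1 (a, z i1))) (fi (existT _ i2 (a', z i2))) m.
suff hS i1 i2 : S i1 i2 = 0.
  rewrite -(fK i) -(fK j); case: (f i) => i1 [a b]; case: (f j) => i2 [a' b'].
  by rewrite (zE _ b) (zE _ b'); have /matrixP/(_ a a') := hS i1 i2; rewrite !mxE.
have sum1 (R : nmodType) (F : idx -> R) :
    \sum_(u : 'I_n) F (f u) = \sum_i \sum_(a < d i) F (existT _ i (a, z i)).
  transitivity (\sum_x F x).
    by rewrite [RHS](reindex f) //; exists fi => x _; [apply: fK|apply: fiK].
  rewrite sum_idx; apply: eq_bigr => i3 _; apply: eq_bigr => a _.
  rewrite (bigD1 (z i3)) //= big1 ?addr0 // => b.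
  by rewrite [b]zE eqxx.
have key : (q ^ m * lam i1) *: (Jm k (d i1) *m S i1 i2) = lam i2 *: (S i1 i2 *m Jm k (d i2)).
  apply/matrixP => a a'; rewrite !mxE.
  have := qconj_by_coef m (fi (existT _ i1 (a, z i1))) (fi (existT _ i2 (a', z i2))) cT.
  under eq_bigr => u _ do rewrite -{2}(fK u).
  under [X in _ = X -> _]eq_bigr => u _ do rewrite -{1}(fK u).
  rewrite (sum1 _ (fun x => Gam (f (fi (existT _ i1 (a, z i1)))) x *
     (q ^ m * T (fi x) (fi (existT _ i2 (a', z i2))) m))).
  rewrite (sum1 _ (fun x => T (fi (existT _ i1 (a, z i1))) (fi x) m *
     Gam x (f (fi (existT _ i2 (a', z i2)))))).
  rewrite !fiK (bigD1 i1) //= [X in _ + X]big1 ?addr0 => [|i3 ne]; last first.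
    by rewrite big1 // => c _; rewrite /Gam /= eq_sym (negPf ne) mul0r.
  rewrite [in RHS](bigD1 i2) //= [X in _ = _ + X]big1 ?addr0 => [e|i3 ne]; last first.
    by rewrite big1 // => c _; rewrite /Gam /= (negPf ne) mulr0.
  rewrite mulr_sumr mulr_sumr.
  transitivity (\sum_(c < d i1) Gam (existT _ i1 (a, z i1)) (existT _ i1 (c, z i1)) *
      (q ^ m * T (fi (existT _ i1 (c, z i1))) (fi (existT _ i2 (a', z i2))) m)).
    by apply: eq_bigr => c _; rewrite !mxE /Gam /= eqxx; ring.
  by rewrite e; apply: eq_bigr => c _; rewrite !mxE /Gam /= eqxx; ring.
apply: (Jm_sylvester (nu := q ^ m * lam i1 / lam i2)) => //.
  apply: contraNneq m0 => e; apply/eqP; apply: (hn (i := i2) (j := i1)).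
  by rewrite -[LHS]mul1r -e divfK.
apply: (scalerI (lam0 i2)); rewrite -key scalerA; congr (_ *: _).
by field.
Qed.

(** [T] and its inverse are constant, so [T L0 = L0]; all exponents of the model vanish, so
    [g0 L0 = L0] as well, and [kappa_fix] applies. *)
Lemma kappa_trivial T : qconj_by q T g0 g0 -> kappa q T g0 g0 = 1.
Proof.
have hg : is_GL g0 := model_GL fK fiK r0 lam0.
have lg : lat g0 = L0 (n := n).
  rewrite -diaglat0 (lat_model fK fiK r0 lam0); congr diaglat; apply/funext => i.
  by rewrite /sexp; case: ifP.
have pres T' : qconj_by q T' g0 g0 -> forall v, L0 (n := n) v -> L0 (n := n) (matvec T' v).
  move=> cT v; rewrite -!diaglat0; apply: supp_matvec => i j; rewrite subr0 => m hm.
  by apply: qconj_by_const => //; rewrite lt_eqF.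
move=> cT; have [hT _] := cT.
have [Z [cZ _ TZ]] := qconj_by_inv q0 hg hg cT; have [hZ _] := cZ.
apply: kappa_fix => //; apply/funext => v; apply/propext; split.
  by move=> [w [hw ->]]; apply: pres.
move=> hv; exists (matvec Z v); split; first exact: pres.
have vv := klattice_vec (L0_klattice k n) hv.
by rewrite matvecA ?TZ ?matvec1 //; apply: GL_mat.
Qed.
End Constant.
End Regular.
End Cases.

Theorem mainTheorem11
  (k : closedFieldType) (char0 : [pchar k] =i pred0)
  (q : k) (q_unit : q != 0) (q_not_root : forall m : nat, (0 < m)%N -> q ^+ m != 1)
  (n : nat) (g : mat k 'I_n 'I_n) (g_GL : is_GL g)
  (l : nat) (d s : 'I_l -> nat) (r : 'I_l -> int) (lam : 'I_l -> k)
  (d_pos : forall i, (0 < d i)%N) (s_pos : forall i, (0 < s i)%N)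
  (rs_coprime : forall i, coprime (absz (r i)) (s i))
  (lam_unit : forall i, lam i != 0)
  (g_decomp : dq_iso q (module_of g) (decomp d s r lam)) :
  let in_fiber (x : tgl k n) := tvalid x /\ qconj q g x.1 in
  ((exists i, r i != 0) ->
     (exists x, in_fiber x) /\
     (forall x x', in_fiber x -> in_fiber x' -> tqconj q x x'))
  /\
  ((forall i, r i = 0) ->
     (exists x, in_fiber x) /\
     (forall x x', in_fiber x -> in_fiber x' ->
        exists c : k, [/\ c != 0, tqconj q (tscale c x) x' &
           forall c' : k, c' != 0 -> tqconj q (tscale c' x) x' -> c' = c])).
Proof.
move=> in_fiber.
have mG : is_mat (@dq_mat k (decomp d s r lam)) by rewrite model_mxE => i j; apply: lvalP.
have [f [fi [Y0 [fK fiK h0 c0]]]] := model_reindex q_unit g_GL mG g_decomp.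
split.
  move=> [i0 hr]; split; first exact: fiber_ex.
  apply: (fiber_one_class q_unit g_GL h0 c0) => c nc.
  exact: (kappa_surj q_unit d_pos s_pos fK fiK lam_unit hr nc).
move=> hr; split; first exact: fiber_ex.
(* [gcd(0, s) = s], so coprimality leaves only [s = 1]. *)
have s1 i : s i = 1%N by have := rs_coprime i; rewrite hr /coprime absz0 gcd0n => /eqP.
have r0 : r = fun _ => 0 by apply/funext.
subst r.
(* The reference matrix of the fibre is moved on to the normalised model, through the conjugator
   [P Y0]. *)
have [lam' [a [n0 hn ha]]] := normalise q_unit q_not_root lam_unit.
have [P cP] := normalise_qconj_by f s1 ha.
have h1 := model_GL fK fiK (fun _ => 0) n0.
have c1 := qconj_by_mul q_unit g_GL h0 h1 c0 cP.
apply: (fiber_torsor q_unit g_GL h1 c1) => T cT.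
exact: (kappa_trivial q_unit d_pos s_pos fK fiK s1 n0 hn cT).
Qed.
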